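(* Let $(G/H,\Pi)$ be a coisotropic Poisson quotient of a Poisson-Lie group $(G,\Pi_G)$. If $(G/H,\Pi)$ is unimodular, that is, if for a volume form $\nu$ on $G/H$ the modular vector field satisfies $\mathcal{M}_\nu^\Pi=X^\Pi_{\hat F}$ for some $\hat F\in C^\infty(G/H)$, then $\mathfrak{h}^0$ is a unimodular Lie algebra.
   Context: $(G,\Pi_G)$ is a connected Poisson-Lie group (a Lie group with a Poisson bivector for which multiplication $G\times G\to G$ is a Poisson map) with Lie algebra $\mathfrak{g}$; $H\subset G$ is a closed connected Lie subgroup with Lie algebra $\mathfrak{h}$; $q:G\to G/H$ is the projection. The dual $\mathfrak{g}^*$ carries the Lie bracket $[\xi,\eta]_{\mathfrak{g}^*}(X)=\delta_{\Pi_G}(X)(\xi,\eta)$, where $\delta_{\Pi_G}(X)=[\overleftarrow{X},\Pi_G](e)\in\wedge^2\mathfrak{g}$ (Schouten bracket, $\overleftarrow{X}$ the left-invariant vector field with value $X$ at $e$). $(G/H,\Pi)$ is a Poisson homogeneous space if $\Pi$ is a Poisson structure on $G/H$ for which the action $(G,\Pi_G)\times(G/H,\Pi)\to(G/H,\Pi)$, $(g,g'H)\mapsto gg'H$, is a Poisson map; it is a coisotropic Poisson quotient if moreover $q:(G,\Pi_G)\to(G/H,\Pi)$ is a Poisson map (equivalently $\Pi(eH)=0$); in that case $\mathfrak{h}^0=\{\xi\in\mathfrak{g}^*:\xi_{|\mathfrak{h}}=0\}$ is a Lie subalgebra of $\mathfrak{g}^*$. For a Poisson manifold $(M,\pi)$: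 $X_h^\pi=i_{dh}\pi$, and for a volume form $\nu$ the modular vector field $\mathcal{M}_\nu^\pi$ is the unique vector field with $\mathcal{L}_{X_h^\pi}\nu=\mathcal{M}_\nu^\pi(h)\,\nu$ for all $h\in C^\infty(M)$. A Lie algebra $\mathfrak{k}$ is unimodular if its modular character $\chi_{\mathfrak{k}}(X)=\mathrm{Tr}(\mathrm{ad}^{\mathfrak{k}}_X)$ vanishes. *)

(* Defs.v *)
From HB Require Import structures.
From mathcomp Require Import all_boot all_order all_algebra.
From mathcomp Require Import all_classical all_reals.
From mathcomp Require Import topology normedtype landau derive.
From mathcomp Require Import ring.

Set Implicit Arguments.
Unset Strict Implicit.
Unset Printing Implicit Defensive.

Import Order.TTheory GRing.Theory Num.Theory.
Import numFieldNormedType.Exports.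
Local Open Scope classical_set_scope.
Local Open Scope ring_scope.

Lemma open_prod (T T' : topologicalType) (U : set T) (U' : set T') :
  open U -> open U' -> open (U `*` U').
Proof.
rewrite !openE => Uo Uo' [x y] [/= Ux Uy].
by exists (U, U') => //; split; [exact: Uo|exact: Uo'].
Qed.

Section Ck.
Context {R : realType}.

(* Meant for U open.  For V finite-dimensional this is the usual class C^k:  *)
(* f is C^(k+1) iff it is differentiable and all its directional derivatives *)
(* are C^k.                                                                  *)
Fixpoint Ck (k : nat) {V W : normedModType R} (U : set V) (f : V -> W) : Prop :=
  match k with
  | 0 => forall x, U x -> {for x, continuous f}
  | k'.+1 => (forall x, U x -> differentiable f x) /\
             (forall v, Ck k' U ('D_v f))
  end.

Definition Cinf {V W : normedModType R} (U : set V) (f : V -> W) : Prop :=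
  forall k, Ck k U f.

Lemma CkW k (V W : normedModType R) (U : set V) (f : V -> W) :
  Ck k.+1 U f -> Ck k U f.
Proof.
elim: k f => [|k IH] f [df Df].
  by move=> x Ux; apply: differentiable_continuous; exact: df.
by split=> // v; apply: IH; exact: Df.
Qed.

Lemma near_eq_differentiable (V W : normedModType R) (f g : V -> W) (x : V) :
  (\forall y \near x, f y = g y) -> differentiable f x -> differentiable g x.
Proof.
move=> fg dfx.
have fgx : f x = g x by exact: nbhs_singleton fg.
have [dfc dfE] := (diff_locallyP x f).1 dfx.
have gE : g \o shift x = cst (g x) + ('d f x : V -> W) +o_ 0 id.
  apply/eqaddoP => e e0.
  have fge : \forall h \near 0, f (x + h) = g (x + h).
    by move/nbhs0P: fg.
  have := (eqaddoP _ _ _ _).1 dfE e e0; apply: filterS2 fge => h fgh.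
  rewrite !fctE /= ![h + x]addrC -fgx -fgh => H; exact: H.
have dgf := diff_unique dfc gE.
by apply/diff_locallyP; rewrite dgf.
Qed.

Lemma eq_Ck k (V W : normedModType R) (U : set V) (f g : V -> W) :
  open U -> (forall x, U x -> f x = g x) -> Ck k U f -> Ck k U g.
Proof.
move=> Uo; elim: k f g => [|k IH] f g fg.
  move=> cf x Ux; rewrite /prop_for /continuous_at -(fg _ Ux).
  apply: cvg_trans (cf x Ux); apply: near_eq_cvg.
  near=> y; rewrite fg//; near: y; exact: open_nbhs_nbhs.
have near_fg x : U x -> \forall y \near x, f y = g y.
  by move=> Ux; near=> y; rewrite fg//; near: y; exact: open_nbhs_nbhs.
case=> df Df; split=> [x Ux|v].
  by apply: near_eq_differentiable (df x Ux); exact: near_fg.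
apply: (IH ('D_v f)); last exact: Df.
move=> x Ux; have [->|v0] := eqVneq v 0; first by rewrite !derive0.
by apply: near_eq_derive => //; exact: near_fg.
Unshelve. all: by end_near. Qed.

Lemma Ck_cst k (V W : normedModType R) (U : set V) (a : W) : Ck k U (cst a).
Proof.
elim: k a => [|k IH] a; first by move=> x _; exact: cst_continuous.
split=> [x _|v]; first exact: differentiable_cst.
have -> : 'D_v (cst a) = cst 0 :> (V -> W).
  by apply/funext => x; rewrite derive_cst.
exact: IH.
Qed.

Lemma Ck_id k (V : normedModType R) (U : set V) : Ck k U (@idfun V).
Proof.
case: k => [|k]; first by move=> x _; exact: cvg_id.
split=> [x _|v]; first exact: ex_diff.
have -> : 'D_v (@idfun V) = cst v by apply/funext => x; rewrite derive_id.
exact: Ck_cst.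
Qed.

Lemma CkD k (V W : normedModType R) (U : set V) (f g : V -> W) :
  open U -> Ck k U f -> Ck k U g -> Ck k U (f + g).
Proof.
move=> Uo; elim: k f g => [|k IH] f g.
  by move=> cf cg x Ux; apply: cvgD; [exact: cf|exact: cg].
case=> df Df [dg Dg]; split=> [x Ux|v].
  by apply: differentiableD; [exact: df|exact: dg].
apply: (eq_Ck Uo) (IH _ _ (Df v) (Dg v)) => x Ux.
by rewrite deriveD //; apply: diff_derivable; [exact: df|exact: dg].
Qed.

Lemma CkM k (V : normedModType R) (U : set V) (f g : V -> R^o) :
  open U -> Ck k U f -> Ck k U g -> Ck k U (f * g).
Proof.
move=> Uo; elim: k f g => [|k IH] f g.
  by move=> cf cg x Ux; apply: cvgM; [exact: cf|exact: cg].
move=> Cf Cg; have [df Df] := Cf; have [dg Dg] := Cg; split=> [x Ux|v].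
  by apply: differentiableM; [exact: df|exact: dg].
apply: (@eq_Ck _ _ _ _ (f * 'D_v g + g * 'D_v f)) => // [x Ux|].
  by rewrite deriveM //; apply: diff_derivable; [exact: df|exact: dg].
by apply: CkD => //; apply: IH; first [exact: Df|exact: Dg|exact: CkW].
Qed.

Lemma Ck_prod_map k (V V' W W' : normedModType R) (U : set V) (U' : set V')
    (f : V -> W) (g : V' -> W') : open U -> open U' ->
  Ck k U f -> Ck k U' g ->
  Ck k (U `*` U') (fun z : V * V' => (f z.1, g z.2)).
Proof.
move=> Uo Uo'; elim: k f g => [|k IH] f g.
  move=> cf cg [x y] [/= Ux Uy]; apply: cvg_pair.
    by apply: (@cvg_comp _ _ _ fst f); [exact: cvg_fst|exact: cf].
  by apply: (@cvg_comp _ _ _ snd g); [exact: cvg_snd|exact: cg].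
case=> df Df [dg Dg].
have cfst : continuous (@fst V V') by move=> x; exact: cvg_fst.
have csnd : continuous (@snd V V') by move=> x; exact: cvg_snd.
have dfst z : differentiable (@fst V V') z by exact: linear_differentiable.
have dsnd z : differentiable (@snd V V') z by exact: linear_differentiable.
have dfz z : U z.1 -> differentiable (f \o @fst V V') z.
  by move=> Uz; apply: differentiable_comp => //; exact: df.
have dgz z : U' z.2 -> differentiable (g \o @snd V V') z.
  by move=> Uz; apply: differentiable_comp => //; exact: dg.
have dfg z : U z.1 -> U' z.2 ->
    differentiable (fun z : V * V' => (f z.1, g z.2)) z.
  by move=> Uz Uz'; apply: differentiable_pair; [exact: dfz|exact: dgz].
split=> [z [Uz Uz']|[v v']]; first exact: dfg.
apply: (@eq_Ck _ _ _ _ (fun z : V * V' => ('D_v f z.1, 'D_v' g z.2))).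
- exact: open_prod.
- move=> z [Uz Uz']; rewrite [RHS]deriveE; last exact: dfg.
  have -> : 'd (fun z : V * V' => (f z.1, g z.2)) z =
      (fun y => ('d (f \o fst) z y, 'd (g \o snd) z y)) :> (V * V' -> W * W').
    by apply: (@diff_pair _ _ _ _ (f \o fst) (g \o snd)); [exact: dfz|exact: dgz].
  have dfstE : 'd (@fst V V') z = @fst V V' :> (V * V' -> V).
    exact: (@diff_lin _ _ _ (@fst V V')).
  have dsndE : 'd (@snd V V') z = @snd V V' :> (V * V' -> V').
    exact: (@diff_lin _ _ _ (@snd V V')).
  rewrite (@diff_comp _ _ _ _ fst f) //; last exact: df.
  rewrite (@diff_comp _ _ _ _ snd g) //; last exact: dg.
  rewrite /= dfstE dsndE /=.
  by congr pair; rewrite deriveE //; [exact: df|exact: dg].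
- exact: (IH _ _ (Df v) (Dg v')).
Qed.

Lemma Ck_slicel k (V V' W : normedModType R) (U : set (V * V')) (b : V')
    (f : V * V' -> W) :
  Ck k U f -> Ck k [set u | U (u, b)] (fun u => f (u, b)).
Proof.
have dpair u : is_diff u (fun v : V => (v, b)) (fun v => (v, 0)).
  exact: is_diff_eq.
elim: k f => [|k IH] f.
  move=> cf u Uu; apply: (@continuous_comp _ _ _ (fun v : V => (v, b)) f); last exact: cf.
  by apply: differentiable_continuous; exact: ex_diff.
case=> df Df; split=> [u Uu|v].
  have dfu : differentiable f (u, b) by exact: df.
  have dpu : differentiable (fun v : V => (v, b)) u by exact: ex_diff.
  exact: (differentiable_comp dpu dfu).
have -> : 'D_v (fun u => f (u, b)) = (fun u => 'D_(v, 0) f (u, b)).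
  apply/funext => u; rewrite /derive.
  have E (h : R) : h^-1 *: (((fun u => f (u, b)) \o shift u) (h *: v) - f (u, b)) =
      h^-1 *: ((f \o shift (u, b)) (h *: (v, 0)) - f (u, b)).
    rewrite /=; have -> : h *: (v, 0) + (u, b) = (h *: v + u, h *: 0 + b) by [].
    by rewrite scaler0 add0r.
  by rewrite (funext E).
exact: (IH _ (Df (v, 0))).
Qed.

Lemma Ck_slicer k (V V' W : normedModType R) (U : set (V * V')) (a : V)
    (f : V * V' -> W) :
  Ck k U f -> Ck k [set u | U (a, u)] (fun u => f (a, u)).
Proof.
have dpair u : is_diff u (fun v : V' => (a, v)) (fun v => (0, v)).
  exact: is_diff_eq.
elim: k f => [|k IH] f.
  move=> cf u Uu; apply: (@continuous_comp _ _ _ (fun v : V' => (a, v)) f); last exact: cf.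
  by apply: differentiable_continuous; exact: ex_diff.
case=> df Df; split=> [u Uu|v].
  have dfu : differentiable f (a, u) by exact: df.
  have dpu : differentiable (fun v : V' => (a, v)) u by exact: ex_diff.
  exact: (differentiable_comp dpu dfu).
have -> : 'D_v (fun u => f (a, u)) = (fun u => 'D_(0, v) f (a, u)).
  apply/funext => u; rewrite /derive.
  have E (h : R) : h^-1 *: (((fun u => f (a, u)) \o shift u) (h *: v) - f (a, u)) =
      h^-1 *: ((f \o shift (a, u)) (h *: (0, v)) - f (a, u)).
    rewrite /=; have -> : h *: (0, v) + (a, u) = (h *: 0 + a, h *: v + u) by [].
    by rewrite scaler0 add0r.
  by rewrite (funext E).
exact: (IH _ (Df (0, v))).
Qed.
End Ck.

(* chart_map is meaningful on chart_dom only, chart_inv on chart_img only. *)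
Record chart (M E : Type) := Chart {
  chart_dom : set M;
  chart_map : M -> E;
  chart_inv : E -> M }.

Definition chart_img (M E : Type) (c : chart M E) : set E :=
  chart_map c @` chart_dom c.

Definition is_chart (M E : topologicalType) (c : chart M E) : Prop :=
  [/\ open (chart_dom c),
      open (chart_img c),
      forall x, chart_dom c x -> chart_inv c (chart_map c x) = x,
      forall x, chart_dom c x -> {for x, continuous (chart_map c)}
    & forall u, chart_img c u -> {for u, continuous (chart_inv c)}].

Lemma open_chart_img (M E : topologicalType) (c : chart M E) (W : set M) :
  is_chart c -> open W -> open (chart_map c @` (chart_dom c `&` W)).
Proof.
case=> co io cK cc ic; rewrite !openE => Wo _ [x [cx Wx] <-].
have ix : chart_img c (chart_map c x) by exists x.
have Wn : nbhs (chart_inv c (chart_map c x)) W by rewrite cK//; exact: Wo.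
have := ic _ ix W Wn; move: (open_nbhs_nbhs (conj io ix)).
apply: filterS2 => _ [y cy <-] /=; rewrite cK// => Wy.
by exists y.
Qed.

(* Spaces with a smooth atlas modelled on E; manifolds are Hausdorff and      *)
(* second countable in addition.  An atlas need not be maximal.               *)
HB.mixin Record hasAtlas (R : realType) (E : normedModType R) M
    of Topological M := {
  atlas : set (chart M E);
  atlas_chart : forall c, atlas c -> is_chart c;
  atlas_cover : forall x : M, exists2 c, atlas c & chart_dom c x;
  atlas_compat : forall c c', atlas c -> atlas c' ->
    Cinf (chart_map c @` (chart_dom c `&` chart_dom c'))
         (chart_map c' \o chart_inv c) }.

#[short(type="atlasType")]
HB.structure Definition Atlas (R : realType) (E : normedModType R) :=
  {M of hasAtlas R E M & Topological M}.

HB.mixin Record isHausdorffSecondCountable M of Topological M := {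
  manifold_hausdorff : hausdorff_space M;
  manifold_second_countable : @second_countable M }.

#[short(type="manifoldType")]
HB.structure Definition Manifold (R : realType) (n : nat) :=
  {M of isHausdorffSecondCountable M & @Atlas R 'rV[R]_n M}.

Section line.
Context {R : realType}.

Definition line_chart : chart R^o R^o := Chart setT id id.

Let line_charts : set (chart R^o R^o) := [set line_chart].

Let line_is_chart c : line_charts c -> is_chart c.
Proof.
move=> ->; split => //=; [exact: openT| |by move=> *; exact: cvg_id..].
rewrite /chart_img /= image_id; exact: openT.
Qed.

Let line_cover (x : R^o) : exists2 c, line_charts c & chart_dom c x.
Proof. by exists line_chart. Qed.

Let line_compat c c' : line_charts c -> line_charts c' ->
  Cinf (chart_map c @` (chart_dom c `&` chart_dom c'))
       (chart_map c' \o chart_inv c).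
Proof. by move=> -> -> k; exact: Ck_id. Qed.

HB.instance Definition _ :=
  hasAtlas.Build R R^o R^o line_is_chart line_cover line_compat.
End line.

Section product.
Context {R : realType} {E E' : normedModType R}.

Definition prod_chart {M M' : Type} (c : chart M E) (c' : chart M' E') :
    chart (M * M') (E * E') :=
  Chart (chart_dom c `*` chart_dom c')
        (fun z => (chart_map c z.1, chart_map c' z.2))
        (fun z => (chart_inv c z.1, chart_inv c' z.2)).

Context (M : atlasType E) (M' : atlasType E').

Let prod_charts : set (chart (M * M') (E * E')) :=
  [set prod_chart z.1 z.2 | z in (@atlas _ _ M) `*` (@atlas _ _ M')].

Let prod_imgE (c d : chart M E) (c' d' : chart M' E') :
  chart_map (prod_chart c c') @`
    (chart_dom (prod_chart c c') `&` chart_dom (prod_chart d d')) =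
  (chart_map c @` (chart_dom c `&` chart_dom d)) `*`
  (chart_map c' @` (chart_dom c' `&` chart_dom d')).
Proof.
apply/seteqP; split=> [z [[x y] [[/= cx cy] [/= dx dy]] <-]|[u v]] /=.
  by split; [exists x|exists y].
by case=> /= -[x [cx dx] <-] [y [cy dy] <-]; exists (x, y).
Qed.

Let prod_imgE1 (c : chart M E) (c' : chart M' E') :
  chart_img (prod_chart c c') = chart_img c `*` chart_img c'.
Proof.
by have := prod_imgE c c c' c'; rewrite !setIid.
Qed.

Let prod_map_continuous (T T' U U' : topologicalType) (f : T -> U)
    (g : T' -> U') (z : T * T') :
  {for z.1, continuous f} -> {for z.2, continuous g} ->
  {for z, continuous (fun z => (f z.1, g z.2))}.
Proof.
move=> cf cg; apply: cvg_pair => /=.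
  by apply: (@continuous_comp _ _ _ fst f) => //; exact: cvg_fst.
by apply: (@continuous_comp _ _ _ snd g) => //; exact: cvg_snd.
Qed.

Let prod_is_chart c : prod_charts c -> is_chart c.
Proof.
case=> -[c1 c2] [/= /atlas_chart -[p1 i1 k1 f1 g1] /atlas_chart -[p2 i2 k2 f2 g2]].
move=> <-; split.
- exact: open_prod.
- by rewrite prod_imgE1; exact: open_prod.
- by move=> [x y] [/= cx cy]; rewrite k1 // k2.
- by move=> z [? ?]; apply: prod_map_continuous; [exact: f1|exact: f2].
- rewrite prod_imgE1 => z [? ?].
  by apply: prod_map_continuous; [exact: g1|exact: g2].
Qed.

Let prod_cover z : exists2 c, prod_charts c & chart_dom c z.
Proof.
have [c cA cz] := atlas_cover z.1; have [d dA dz] := atlas_cover z.2.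
by exists (prod_chart c d) => //; exists (c, d).
Qed.

Let prod_compat c d : prod_charts c -> prod_charts d ->
  Cinf (chart_map c @` (chart_dom c `&` chart_dom d))
       (chart_map d \o chart_inv c).
Proof.
move=> [[c1 c2] [/= c1A c2A] <-] [[d1 d2] [/= d1A d2A] <-] k.
rewrite prod_imgE.
apply: (@Ck_prod_map _ _ _ _ _ _ _ _ (chart_map d1 \o chart_inv c1)
  (chart_map d2 \o chart_inv c2)).
- by apply: open_chart_img; [exact: atlas_chart|have [] := atlas_chart _ d1A].
- by apply: open_chart_img; [exact: atlas_chart|have [] := atlas_chart _ d2A].
- exact: atlas_compat.
- exact: atlas_compat.
Qed.

HB.instance Definition _ :=
  hasAtlas.Build R (E * E')%type (M * M')%type
    prod_is_chart prod_cover prod_compat.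
End product.

Section smooth.
Context {R : realType} {E F : normedModType R}.

(* Meant for W open. *)
Definition smooth_on (M : atlasType E) (N : atlasType F) (W : set M)
    (f : M -> N) : Prop :=
  (forall x, W x -> {for x, continuous f}) /\
  forall (c : chart M E) (d : chart N F), atlas c -> atlas d ->
    Cinf (chart_map c @` (chart_dom c `&` W `&` f @^-1` chart_dom d))
         (chart_map d \o f \o chart_inv c).

Definition smooth (M : atlasType E) (N : atlasType F) (f : M -> N) : Prop :=
  smooth_on setT f.
End smooth.

Section smooth_fun.
Context {R : realType} {E : normedModType R} (M : atlasType E).

Definition smooth_pred : {pred M -> R^o} :=
  fun f => `[< smooth (f : M -> R^o) >].

Record smooth_fun := SmoothFun {
  smooth_val :> M -> R^o;
  _ : smooth_val \in smooth_pred }.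

HB.instance Definition _ := [isSub for smooth_val].
HB.instance Definition _ := [Choice of smooth_fun by <:].

Lemma smooth_predP (f : M -> R^o) :
  (f \in smooth_pred) <->
  continuous f /\
  forall c : chart M E, atlas c -> Cinf (chart_img c) (f \o chart_inv c).
Proof.
split=> [/asboolP[cf Cf]|[cf Cf]].
  split=> [x|c cA]; first exact: cf.
  have := Cf c line_chart cA erefl.
  by rewrite setIT preimage_setT setIT.
apply/asboolP; split=> [x _|c d cA ->]; first exact: cf.
by rewrite setIT preimage_setT setIT; exact: Cf.
Qed.

Let img_open (c : chart M E) : atlas c -> open (chart_img c).
Proof. by move=> /atlas_chart[]. Qed.

Let smooth_cst (a : R^o) : cst a \in smooth_pred.
Proof.
by apply/smooth_predP; split=> [x|c _ k]; [exact: cst_continuous|exact: Ck_cst].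
Qed.

Let smoothM (f g : M -> R^o) :
  f \in smooth_pred -> g \in smooth_pred -> f * g \in smooth_pred.
Proof.
move=> /smooth_predP[cf Cf] /smooth_predP[cg Cg]; apply/smooth_predP.
split=> [x|c cA k]; first by apply: cvgM; [exact: cf|exact: cg].
apply: (@CkM _ _ _ _ (f \o chart_inv c) (g \o chart_inv c)).
- exact: img_open.
- exact: Cf.
- exact: Cg.
Qed.

Let smoothD (f g : M -> R^o) :
  f \in smooth_pred -> g \in smooth_pred -> f + g \in smooth_pred.
Proof.
move=> /smooth_predP[cf Cf] /smooth_predP[cg Cg]; apply/smooth_predP.
split=> [x|c cA k]; first by apply: cvgD; [exact: cf|exact: cg].
apply: (@CkD _ _ _ _ _ (f \o chart_inv c) (g \o chart_inv c)).
- exact: img_open.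
- exact: Cf.
- exact: Cg.
Qed.

Let smoothZ a (f : M -> R^o) : f \in smooth_pred -> a *: f \in smooth_pred.
Proof. exact: (@smoothM (cst a) f (smooth_cst a)). Qed.

Lemma smooth_pred_subring : subring_closed smooth_pred.
Proof.
split=> [|f g Sf Sg|]; [exact: smooth_cst| |exact: smoothM].
by apply: smoothD => //; rewrite -scaleN1r; exact: smoothZ.
Qed.

Lemma smooth_pred_submod : subsemimod_closed smooth_pred.
Proof.
split; last by move=> a f; exact: smoothZ.
by split=> [|f g]; [exact: smooth_cst|exact: smoothD].
Qed.

HB.instance Definition _ :=
  GRing.isSubringClosed.Build (M -> R^o) smooth_pred smooth_pred_subring.
HB.instance Definition _ :=
  GRing.SubChoice_isSubComPzRing.Build (M -> R^o) smooth_pred smooth_fun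
    smooth_pred_subring.
HB.instance Definition _ :=
  GRing.SubZmodule_isSubLmodule.Build R (M -> R^o) smooth_pred smooth_fun
    smooth_pred_submod.

Lemma smooth_funP (f g : smooth_fun) : (forall x, f x = g x) -> f = g.
Proof. by move=> fg; apply/val_inj/funext. Qed.
End smooth_fun.
Arguments smooth_pred {R E M}.

Section slices.
Context {R : realType} {E E' : normedModType R}.
Context {M : atlasType E} {M' : atlasType E'}.

Let slicel_subproof (f : smooth_fun (M * M')%type) (y : M') :
  (fun x : M => f (x, y) : R^o) \in smooth_pred.
Proof.
have /smooth_predP[cf Cf] := valP f; apply/smooth_predP; split=> [x|c cA k].
  apply: (@continuous_comp _ _ _ (fun x => (x, y)) f); last exact: cf.
  by apply: cvg_pair => /=; [exact: cvg_id|exact: cvg_cst].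
have [d dA dy] := atlas_cover y.
have cdA : atlas (prod_chart c d) by exists (c, d).
have := Ck_slicel (chart_map d y) (Cf _ cdA k).
have -> : [set u | chart_img (prod_chart c d) (u, chart_map d y)] = chart_img c.
  apply/seteqP; split=> [u [[x z] [/= cx _] [<- _]]|u [x cx <-]] /=.
    by exists x.
  by exists (x, y).
rewrite /=; have [_ _ dK _ _] := atlas_chart _ dA; rewrite dK //.
Qed.

Let slicer_subproof (f : smooth_fun (M * M')%type) (x : M) :
  (fun y : M' => f (x, y) : R^o) \in smooth_pred.
Proof.
have /smooth_predP[cf Cf] := valP f; apply/smooth_predP; split=> [y|d dA k].
  apply: (@continuous_comp _ _ _ (fun y => (x, y)) f); last exact: cf.
  by apply: cvg_pair => /=; [exact: cvg_cst|exact: cvg_id].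
have [c cA cx] := atlas_cover x.
have cdA : atlas (prod_chart c d) by exists (c, d).
have := Ck_slicer (chart_map c x) (Cf _ cdA k).
have -> : [set u | chart_img (prod_chart c d) (chart_map c x, u)] = chart_img d.
  apply/seteqP; split=> [u [[z y] [/= _ dy] [_ <-]]|u [y dy <-]] /=.
    by exists y.
  by exists (x, y).
rewrite /=; have [_ _ cK _ _] := atlas_chart _ cA; rewrite cK //.
Qed.

Definition slicel f y : smooth_fun M := SmoothFun (slicel_subproof f y).
Definition slicer f x : smooth_fun M' := SmoothFun (slicer_subproof f x).
End slices.

Section dual.
Context {R : realType} (V : lmodType R).

Definition linear_form_pred : {pred V -> R^o} :=
  fun f => `[< forall a u v, f (a *: u + v) = a *: f u + f v >].

Record dual := Dual { dual_val :> V -> R^o; _ : dual_val \in linear_form_pred }.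

HB.instance Definition _ := [isSub for dual_val].
HB.instance Definition _ := [Choice of dual by <:].

Lemma linear_form_submod : subsemimod_closed linear_form_pred.
Proof.
split; first split=> [|f g /asboolP lf /asboolP lg].
- apply/asboolP => a u v; change (0 = a *: 0 + 0 :> R^o).
  by rewrite scaler0 addr0.
- apply/asboolP => a u v.
  change (f (a *: u + v) + g (a *: u + v) = a *: (f u + g u) + (f v + g v)).
  by rewrite lf lg scalerDr addrACA.
- move=> b f /asboolP lf; apply/asboolP => a u v.
  change (b *: f (a *: u + v) = a *: (b *: f u) + b *: f v).
  by rewrite lf scalerDr !scalerA mulrC.
Qed.

HB.instance Definition _ :=
  GRing.isSubmodClosed.Build R (V -> R^o) linear_form_pred linear_form_submod.
HB.instance Definition _ :=
  GRing.SubChoice_isSubLmodule.Build R (V -> R^o) linear_form_pred dual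
    linear_form_submod.

Definition annihilator (U : set V) : set dual :=
  [set xi | forall u, U u -> xi u = 0].
End dual.

Section lie_algebra.
Context {R : realType} {V : lmodType R} (K : set V).

Definition is_subspace : Prop :=
  K 0 /\ forall a u v, K u -> K v -> K (a *: u + v).

Definition is_basis (n : nat) (b : 'I_n -> V) : Prop :=
  (forall i, K (b i)) /\
  forall v, K v -> exists! c : 'rV[R]_n, v = \sum_i c 0 i *: b i.

(* The trace of an endomorphism phi of the finite-dimensional space K. *)
Definition trace_on (phi : V -> V) : R :=
  xget 0 [set t | exists n (b : 'I_n -> V) (A : 'M[R]_n),
    [/\ is_basis b, forall j, phi (b j) = \sum_i A i j *: b i & t = \tr A]].

Context (br : V -> V -> V).

Record is_lie_algebra : Prop := {
  lie_subspace : is_subspace;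
  lie_finite_dim : exists n (b : 'I_n -> V), is_basis b;
  lie_closed : forall u v, K u -> K v -> K (br u v);
  lie_linearl : forall a u v w, K u -> K v -> K w ->
    br (a *: u + v) w = a *: br u w + br v w;
  lie_linearr : forall a u v w, K u -> K v -> K w ->
    br w (a *: u + v) = a *: br w u + br w v;
  lie_alternating : forall u, K u -> br u u = 0;
  lie_jacobi : forall u v w, K u -> K v -> K w ->
    br u (br v w) + br v (br w u) + br w (br u v) = 0 }.

Definition modular_character (u : V) : R := trace_on (br u).

Definition is_unimodular_lie_algebra : Prop :=
  is_lie_algebra /\ forall u, K u -> modular_character u = 0.
End lie_algebra.

Section tangent.
Context {R : realType} {E : normedModType R} (M : atlasType E).
Local Notation C := (smooth_fun M).

Definition derivation_at_pred (p : M) : {pred C -> R^o} :=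
  fun v => `[< (forall a f g, v (a *: f + g) = a *: v f + v g) /\
               (forall f g, v (f * g) = f p * v g + g p * v f) >].

Record tangent (p : M) := Tangent {
  tangent_val :> C -> R^o;
  _ : tangent_val \in derivation_at_pred p }.

Section tangent_lmod.
Context (p : M).

HB.instance Definition _ := [isSub for @tangent_val p].
HB.instance Definition _ := [Choice of tangent p by <:].

Lemma derivation_at_submod : subsemimod_closed (derivation_at_pred p).
Proof.
split; first split=> [|v w /asboolP[lv Dv] /asboolP[lw Dw]].
- apply/asboolP; split=> [a f g|f g].
    change (0 = a *: 0 + 0 :> R^o); by rewrite scaler0 addr0.
  change (0 = f p * 0 + g p * 0 :> R^o); by rewrite !mulr0 addr0.
- apply/asboolP; split=> [a f g|f g].
    change (v (a *: f + g) + w (a *: f + g) = a *: (v f + w f) + (v g + w g)).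
    by rewrite lv lw scalerDr addrACA.
  change (v (f * g) + w (f * g) = f p * (v g + w g) + g p * (v f + w f)).
  by rewrite Dv Dw !mulrDr addrACA.
- move=> b v /asboolP[lv Dv]; apply/asboolP; split=> [a f g|f g].
    change (b *: v (a *: f + g) = a *: (b *: v f) + b *: v g).
    by rewrite lv scalerDr !scalerA mulrC.
  change (b *: v (f * g) = f p * (b *: v g) + g p * (b *: v f)).
  by rewrite Dv scalerDr !scalerAr.
Qed.

HB.instance Definition _ :=
  GRing.isSubmodClosed.Build R (C -> R^o) (derivation_at_pred p)
    derivation_at_submod.
HB.instance Definition _ :=
  GRing.SubChoice_isSubLmodule.Build R (C -> R^o) (derivation_at_pred p)
    (tangent p) derivation_at_submod.
End tangent_lmod.

Definition cotangent (p : M) := dual (tangent p).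

Let differential_subproof (p : M) (f : C) :
  (fun v : tangent p => v f) \in linear_form_pred (V := tangent p).
Proof. exact/asboolP. Qed.

Definition differential (p : M) (f : C) : cotangent p :=
  Dual (differential_subproof p f).

Record vfield := VField {
  vfield_val :> C -> C;
  vfield_linear : forall a f g,
    vfield_val (a *: f + g) = a *: vfield_val f + vfield_val g;
  vfield_leibniz : forall f g,
    vfield_val (f * g) = f * vfield_val g + g * vfield_val f }.

Let vfield_at_subproof (X : vfield) (p : M) :
  (fun f => X f p : R^o) \in derivation_at_pred p.
Proof.
by apply/asboolP; split=> *; rewrite (vfield_linear, vfield_leibniz).
Qed.

Definition vfield_at (X : vfield) (p : M) : tangent p :=
  Tangent (vfield_at_subproof X p).

Let lie_bracket_linear (X Y : vfield) a f g :
  X (Y (a *: f + g)) - Y (X (a *: f + g)) =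
  a *: (X (Y f) - Y (X f)) + (X (Y g) - Y (X g)).
Proof. by rewrite !vfield_linear scalerBr opprD addrACA. Qed.

Let vfieldD (X : vfield) f g : X (f + g) = X f + X g.
Proof. by have := vfield_linear X 1 f g; rewrite !scale1r. Qed.

Let lie_bracket_leibniz (X Y : vfield) f g :
  X (Y (f * g)) - Y (X (f * g)) =
  f * (X (Y g) - Y (X g)) + g * (X (Y f) - Y (X f)).
Proof.
rewrite !(vfieldD, vfield_leibniz); ring.
Qed.

Definition lie_bracket (X Y : vfield) : vfield :=
  VField (lie_bracket_linear X Y) (lie_bracket_leibniz X Y).

(* A bivector field as a skew-symmetric biderivation of the algebra of smooth *)
(* functions: w f g stands for w(df, dg).                                     *)
Record bivector := Bivector {
  bivector_val :> C -> C -> C;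
  bivector_linear : forall h a f g,
    bivector_val (a *: f + g) h = a *: bivector_val f h + bivector_val g h;
  bivector_leibniz : forall h f g,
    bivector_val (f * g) h = f * bivector_val g h + g * bivector_val f h;
  bivector_skew : forall f g, bivector_val f g = - bivector_val g f }.

Lemma bivector_linearr (w : bivector) h a f g :
  w h (a *: f + g) = a *: w h f + w h g.
Proof. by rewrite bivector_skew bivector_linear opprD -scalerN -!bivector_skew. Qed.

Lemma bivector_leibnizr (w : bivector) h f g :
  w h (f * g) = f * w h g + g * w h f.
Proof. by rewrite bivector_skew bivector_leibniz opprD -!mulrN -!bivector_skew. Qed.

Definition is_poisson (w : bivector) : Prop :=
  forall f g h, w f (w g h) + w g (w h f) + w h (w f g) = 0.

(* i_{dh} w *)
Definition hamiltonian (w : bivector) (h : C) : vfield :=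
  VField (bivector_linearr w h) (bivector_leibnizr w h).

(* The value of w at p, as a bilinear form on cotangent vectors.  Evaluating  *)
(* xi on the tangent vectors f |-> w(df, dg)(p) gives, as a function of g, a  *)
(* tangent vector again, on which eta is evaluated.                           *)
Section bivector_at.
Context (w : bivector) (p : M).

Let sharpl_subproof (g : C) :
  (fun f => w f g p : R^o) \in derivation_at_pred p.
Proof.
by apply/asboolP; split=> *; rewrite (bivector_linear, bivector_leibniz).
Qed.

Let sharpl (g : C) : tangent p := Tangent (sharpl_subproof g).

Let sharp_subproof (xi : cotangent p) :
  (fun g => xi (sharpl g) : R^o) \in derivation_at_pred p.
Proof.
have /asboolP xi_lin := valP xi.
have xi_lin2 a b (u v : tangent p) : xi (a *: u + b *: v) = a *: xi u + b *: xi v.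
  rewrite xi_lin; congr (_ + _).
  have := xi_lin b v 0; rewrite addr0 => ->.
  have := xi_lin 1 0 0; rewrite !scale1r addr0 => /eqP.
  by rewrite -subr_eq subrr eq_sym => /eqP ->; rewrite addr0.
apply/asboolP; split=> [a f g|f g].
  rewrite -xi_lin; congr (xi _); apply/val_inj/funext => h /=.
  by rewrite bivector_linearr.
rewrite -[f p * _]/(f p *: _) -[g p * _]/(g p *: _) -xi_lin2.
congr (xi _); apply/val_inj/funext => h /=.
by rewrite bivector_leibnizr.
Qed.

Definition sharp (xi : cotangent p) : tangent p := Tangent (sharp_subproof xi).

Definition bivector_at (xi eta : cotangent p) : R := eta (sharp xi).

Lemma bivector_at_differential (f g : C) :
  bivector_at (differential p f) (differential p g) = w f g p.
Proof. by []. Qed.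
End bivector_at.

Section schouten.
Context (X : vfield) (w : bivector).

Let sch (f g : C) : C := X (w f g) - w (X f) g - w f (X g).

Let bivectorD h f g : w (f + g) h = w f h + w g h.
Proof. by have := bivector_linear w h 1 f g; rewrite !scale1r. Qed.

Let sch_linear h a f g : sch (a *: f + g) h = a *: sch f h + sch g h.
Proof.
rewrite /sch !(vfield_linear, bivector_linear) !scalerBr.
by rewrite !opprD !addrA !(addrAC _ (X (w g h))) !(addrAC _ (- w (X g) h)).
Qed.

Let sch_leibniz h f g : sch (f * g) h = f * sch g h + g * sch f h.
Proof.
rewrite /sch !(vfieldD, vfield_leibniz, bivector_leibniz, bivectorD); ring.
Qed.

Let sch_skew f g : sch f g = - sch g f.
Proof.
rewrite /sch (bivector_skew _ f g) (bivector_skew _ (X f)) (bivector_skew _ f).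
have -> : X (- w g f) = - X (w g f).
  have X0 : X 0 = 0.
    by have := vfieldD X 0 0; rewrite addr0 => /eqP; rewrite -subr_eq subrr eq_sym => /eqP.
  by apply/eqP; rewrite -addr_eq0 -vfieldD addNr X0.
ring.
Qed.

Definition schouten : bivector := Bivector sch_linear sch_leibniz sch_skew.
End schouten.
End tangent.

Section forms.
Context {R : realType} {E : normedModType R} (M : atlasType E).

Record form (n : nat) := Form {
  form_at :> forall p : M, ('I_n -> tangent p) -> R;
  form_linear : forall p (v : 'I_n -> tangent p) i a (x y : tangent p),
    form_at [eta v with i |-> a *: x + y] =
    a * form_at [eta v with i |-> x] + form_at [eta v with i |-> y];
  form_alternating : forall p (v : 'I_n -> tangent p) i j,
    i != j -> v i = v j -> form_at v = 0;
  form_smooth : forall Y : 'I_n -> vfield M,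
    (fun p => form_at (fun i => vfield_at (Y i) p) : R^o) \in smooth_pred }.

Context (n : nat).

Definition form_eval (nu : form n) (Y : 'I_n -> vfield M) : smooth_fun M :=
  SmoothFun (form_smooth nu Y).

(* The form L_X nu, evaluated on vector fields Y_0, .., Y_(n-1). *)
Definition lie_derivative (X : vfield M) (nu : form n) (Y : 'I_n -> vfield M) :
    smooth_fun M :=
  X (form_eval nu Y) -
  \sum_(i < n) form_eval nu [eta Y with i |-> lie_bracket X (Y i)].

Definition is_modular_vfield (nu : form n) (w : bivector M) (V : vfield M) :
    Prop :=
  forall h Y, lie_derivative (hamiltonian w h) nu Y = V h * form_eval nu Y.
End forms.

Definition is_volume_form (R : realType) (n : nat) (M : manifoldType R n)
    (nu : form M n) : Prop :=
  forall p : M, exists v : 'I_n -> tangent p, nu p v != 0.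

Definition is_unimodular_poisson (R : realType) (n : nat)
    (M : manifoldType R n) (w : bivector M) : Prop :=
  exists2 nu : form M n, is_volume_form nu &
    exists F : smooth_fun M, is_modular_vfield nu w (hamiltonian w F).

Section poisson_map.
Context {R : realType} {E F : normedModType R}.

Definition bracket (M : atlasType E) (w : bivector M) (f g : smooth_fun M)
    (x : M) : R := w f g x.

(* The bracket of M x N, at a point z, for the product of w and w'. *)
Definition prod_bracket (M : atlasType E) (N : atlasType F) (w : bivector M)
    (w' : bivector N) (f g : smooth_fun (M * N)%type) (z : M * N) : R :=
  w (slicel f z.2) (slicel g z.2) z.1 + w' (slicer f z.1) (slicer g z.1) z.2.

(* Brackets are given here as functions of two smooth functions and a point. *)
Definition is_poisson_map (M : atlasType E) (N : atlasType F)
    (b : smooth_fun M -> smooth_fun M -> M -> R)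
    (b' : smooth_fun N -> smooth_fun N -> N -> R) (phi : M -> N) : Prop :=
  smooth phi /\
  forall (f g : smooth_fun N) (f' g' : smooth_fun M),
    (forall x, f' x = f (phi x)) -> (forall x, g' x = g (phi x)) ->
    forall x, b f' g' x = b' f g (phi x).
End poisson_map.

HB.mixin Record isLieGroup (R : realType) (n : nat) G
    of Manifold R n G & Group G := {
  mulg_smooth : smooth (fun z : G * G => (z.1 * z.2)%g);
  invg_smooth : smooth (fun x : G => (x^-1)%g) }.

#[short(type="lieGroupType")]
HB.structure Definition LieGroup (R : realType) (n : nat) :=
  {G of isLieGroup R n G & Manifold R n G & Group G}.

Section lie_group.
Context {R : realType} {n : nat} (G : lieGroupType R n).

Definition is_poisson_lie (w : bivector G) : Prop :=
  is_poisson w /\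
  is_poisson_map (prod_bracket w w) (bracket w) (fun z : G * G => (z.1 * z.2)%g).

Definition is_subgroup (H : set G) : Prop :=
  H 1%g /\ forall x y, H x -> H y -> H (x^-1 * y)%g.

(* The Lie algebra of a closed subgroup H, inside the Lie algebra T_e G of G: *)
(* the velocities at e of the smooth curves in H.                             *)
Definition lie_algebra_of (H : set G) : set (tangent (1%g : G)) :=
  [set X | exists gamma : R^o -> G,
    [/\ smooth gamma, gamma 0 = 1%g, forall t, H (gamma t)
      & forall f : smooth_fun G, X f = 'D_1 (f \o gamma : R^o -> R^o) 0]].

Definition left_invariant (X : vfield G) : Prop :=
  forall (g : G) (f f' : smooth_fun G),
    (forall x, f' x = f (g * x)%g) -> forall x, X f' x = X f (g * x)%g.

(* The unique covector zeta such that zeta(X(e)) = [X, w](e)(xi, eta) for all *)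
(* left-invariant vector fields X.                                            *)
Definition dual_bracket (w : bivector G) (xi eta : cotangent (1%g : G)) :
    cotangent (1%g : G) :=
  xget 0 [set zeta : cotangent (1%g : G) |
    forall X, left_invariant X ->
      zeta (vfield_at X 1%g) = bivector_at (schouten X w) xi eta].

Context {m : nat} (M : manifoldType R m).

(* q identifies M with the set of left cosets gH, with its unique manifold    *)
(* structure such that q is smooth and has local smooth sections.             *)
Record is_coset_projection (H : set G) (q : G -> M) : Prop := {
  coset_surj : forall x, exists g, q g = x;
  coset_fiber : forall g g', q g = q g' <-> H (g^-1 * g')%g;
  coset_smooth : smooth q;
  coset_section : forall x, exists (W : set M) (s : M -> G),
    [/\ open W, W x, smooth_on W s & forall y, W y -> q (s y) = y] }.

(* (g, g'H) |-> gg'H *)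
Definition coset_action (q : G -> M) (z : G * M) : M :=
  q (z.1 * xget 1 [set g | q g = z.2])%g.

Definition is_poisson_homogeneous (wG : bivector G) (q : G -> M)
    (w : bivector M) : Prop :=
  is_poisson w /\ is_poisson_map (prod_bracket wG w) (bracket w) (coset_action q).

Definition is_coisotropic_quotient (wG : bivector G) (q : G -> M)
    (w : bivector M) : Prop :=
  is_poisson_homogeneous wG q w /\ is_poisson_map (bracket wG) (bracket w) q.
End lie_group.

(* Main.v *)
(** Differentials of functions pulled back along [q] identify the annihilator of
    the Lie algebra of [H] with the cotangent space of [M] at the base point [q e].
    Since [PiG] vanishes at [e], the dual bracket of two differentials is
    [[df, dg] = d(PiG f g)], so on the annihilator it becomes
    [[d(f o q), d(g o q)] = d(Pi f g o q)]: the annihilator is the linearization of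
    [Pi] at its zero [q e].  Hence the modular character at [d(f o q)] is the trace
    of the linearization of the hamiltonian vector field of [f] at [q e], that is, its
    divergence there for any volume form.  For the form with modular
    vector field [hamiltonian Pi F] this divergence is [Pi F f (q e) = 0].

    Tangent vectors being derivations of global smooth functions, all this rests on
    bump functions and Hadamard's lemma, which turn them into directional
    derivatives in a chart and into velocities of curves. *)
Require Import Defs.
From HB Require Import structures.
From mathcomp Require Import all_boot all_order all_algebra.
From mathcomp Require Import all_classical all_reals.
From mathcomp Require Import topology normedtype landau derive.
From mathcomp Require Import sequences exp realfun.
From mathcomp Require Import measure lebesgue_measure lebesgue_integral ftc.
From mathcomp Require Import ring lra.

Set Implicit Arguments.
Unset Strict Implicit.
Unset Printing Implicit Defensive.

Import Order.TTheory GRing.Theory Num.Theory.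
Import numFieldNormedType.Exports.
Local Open Scope classical_set_scope.
Local Open Scope ring_scope.

(** * Calculus of maps of class C^k *)

(** The equation defining the modular vector field is tested on global vector fields only, so using
    it at [q e] on a frame where the volume form is nonzero requires extending arbitrary tangent
    vectors at [q e]. The infinitesimal action of [G] on [M] supplies the extensions: its fields are
    smooth because [coset_action] is, and their values at [q e] fill the tangent space because [q]
    has local sections.

    Two definitions select an object by [xget] and become usable only once it is unique. For
    [dual_bracket] uniqueness comes from the left-invariant fields, which take every value at [e];
    for [trace_on] it comes from invariance under change of basis.

    The Lie algebra of [H] consists of velocities of curves inside [H], whereas the argument needs
    the kernel of the differential of [q]. A local section corrects a curve of [G] whose velocity is
    in that kernel into a curve of [H] with the same velocity.

    Finally everything is the trace of one matrix, with entries [d i (Pi f (y j))] for coordinates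
    [y] at [q e] and the dual frame [d]: the Lie algebra side reads it as an adjoint map, the volume
    form as a divergence. *)

Section Ck_calculus.
Context {R : realType}.
Implicit Types (V W Z : normedModType R).

Lemma Ck_sub k V W (U U' : set V) (f : V -> W) :
  U' `<=` U -> Ck k U f -> Ck k U' f.
Proof.
move=> sU; elim: k f => [|k IH] f /=; first by move=> cf x /sU; exact: cf.
by case=> df Df; split=> [x /sU|v]; [exact: df|exact: IH].
Qed.

(** Each clause of [Ck] is a condition at the points of the set on a function defined everywhere, so
    the pieces need not be open. This makes smoothness a local property. *)
Lemma Ck_bigcup k V W I (D : set I) (U : I -> set V) (f : V -> W) :
  (forall i, D i -> Ck k (U i) f) -> Ck k (\bigcup_(i in D) U i) f.
Proof.
elim: k f => [|k IH] f /= Cf; first by move=> x [i /Cf]; exact.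
split=> [x [i /Cf[]]|v]; [by move=> + _; exact|].
by apply: IH => i /Cf[].
Qed.

Lemma Ck_setU k V W (U U' : set V) (f : V -> W) :
  Ck k U f -> Ck k U' f -> Ck k (U `|` U') f.
Proof.
move=> Cf Cf'.
apply: (@Ck_sub _ _ _ (\bigcup_(b in [set: bool]) (if b then U else U'))).
  by move=> x [Ux|Ux]; [exists true|exists false].
by apply: Ck_bigcup => -[].
Qed.

Lemma Ck_lin_comp k V W Z (U : set V) (L : {linear W -> Z}) (f : V -> W) :
  open U -> continuous L -> Ck k U f -> Ck k U (L \o f).
Proof.
move=> Uo cL; elim: k f => [|k IH] f.
  move=> cf x Ux; apply: continuous_comp; [exact: cf|exact: cL].
case=> df Df; have dLf x : U x -> differentiable (L \o f) x.
  move=> Ux; apply: (@differentiable_comp _ _ _ _ f L); first exact: df.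
  exact: linear_differentiable.
split=> // v; apply: (eq_Ck Uo) (IH _ (Df v)) => x Ux /=.
rewrite [RHS]deriveE; last exact: dLf.
rewrite diff_comp; [|exact: df|exact: linear_differentiable].
by rewrite /= diff_lin // -deriveE //; exact: df.
Qed.

Lemma Ck_lin k V W (U : set V) (L : {linear V -> W}) :
  open U -> continuous L -> Ck k U L.
Proof. by move=> Uo cL; exact: (@Ck_lin_comp k V V W U L idfun _ _ (Ck_id _ _)). Qed.

Lemma CkZl k V W (U : set V) (f : V -> R^o) (w : W) :
  open U -> Ck k U f -> Ck k U (fun x => f x *: w).
Proof.
move=> Uo Cf; have sx_lin : linear ( *:%R ^~ w : R^o -> _).
  by move=> u y z; rewrite scalerDl scalerA.
pose sxL : {linear R^o -> W} :=
  HB.pack ( *:%R ^~ w) (GRing.isLinear.Build _ _ _ _ _ sx_lin).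
by apply: (Ck_lin_comp (L := sxL)) => //; exact: scalel_continuous.
Qed.

Lemma Ck_sum k V W (U : set V) n (f : 'I_n -> V -> W) :
  open U -> (forall i, Ck k U (f i)) -> Ck k U (fun x => \sum_i f i x).
Proof.
move=> Uo Cf; have -> : (fun x => \sum_i f i x) = \sum_i f i.
  by apply/funext => x; rewrite fct_sumE.
by elim/big_ind: _ => // [|? ?]; [exact: (@Ck_cst _ _ _ _ _ 0)|exact: CkD].
Qed.

(* The chain rule is written in such coordinates:                              *)
(* D_v (g o f) = \sum_i (l i (D_v f)) (D_(e i) g o f).                        *)
Definition finite_frame V : Prop :=
  exists n (e : 'I_n -> V) (l : 'I_n -> {linear V -> R^o}),
    (forall i, continuous (l i)) /\ forall x, x = \sum_i l i x *: e i.

Lemma finite_frame_line : finite_frame (R^o : normedModType R).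
Proof.
exists 1, (fun=> 1), (fun=> idfun); split=> [_ x|x]; first exact: cvg_id.
by rewrite big_ord1 /= [_ *: _]mulr1.
Qed.

Lemma finite_frame_rV n : finite_frame ('rV[R]_n : normedModType R).
Proof.
have lin_coord i : linear (fun v : 'rV[R]_n => v 0 i : R^o).
  by move=> a u v; rewrite !mxE.
pose l i : {linear 'rV[R]_n -> R^o} := HB.pack (fun v : 'rV[R]_n => v 0 i : R^o)
  (GRing.isLinear.Build _ _ _ _ _ (lin_coord i)).
exists n, (delta_mx 0), l.
by split=> [i|x /=]; [exact: coord_continuous|exact: row_sum_delta].
Qed.

Lemma finite_frame_prod V W :
  finite_frame V -> finite_frame W -> finite_frame (V * W)%type.
Proof.
move=> [n [e [l [cl le]]]] [n' [e' [l' [cl' le']]]].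
pose E (i : 'I_(n + n')) : V * W :=
  match fintype.split i with inl j => (e j, 0) | inr j => (0, e' j) end.
have lin_l i : linear (fun v : V * W => l i v.1).
  by move=> a u v; rewrite /= linearP.
have lin_l' i : linear (fun v : V * W => l' i v.2).
  by move=> a u v; rewrite /= linearP.
pose Ll j : {linear (V * W)%type -> R^o} := HB.pack (fun v : V * W => l j v.1)
  (GRing.isLinear.Build _ _ _ _ _ (lin_l j)).
pose Lr j : {linear (V * W)%type -> R^o} := HB.pack (fun v : V * W => l' j v.2)
  (GRing.isLinear.Build _ _ _ _ _ (lin_l' j)).
pose L (i : 'I_(n + n')) := match fintype.split i with inl j => Ll j | inr j => Lr j end.
exists (n + n')%N, E, L; split=> [i z|[x y]].
  rewrite /L; case: (fintype.split i) => j.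
    by apply: (@continuous_comp _ _ _ fst (l j)); [exact: cvg_fst|exact: cl].
  by apply: (@continuous_comp _ _ _ snd (l' j)); [exact: cvg_snd|exact: cl'].
rewrite big_split_ord /=.
have HL j : L (lshift n' j) (x, y) *: E (lshift n' j) = (l j x *: e j, 0).
  by rewrite /L /E (unsplitK (inl j)) /=; congr pair; rewrite scaler0.
have HR j : L (rshift n j) (x, y) *: E (rshift n j) = (0, l' j y *: e' j).
  by rewrite /L /E (unsplitK (inr j)) /=; congr pair; rewrite scaler0.
under eq_bigr do rewrite HL.
under [X in _ + X]eq_bigr do rewrite HR.
rewrite [X in X + _](_ : _ = (x, 0)) 1?[X in _ + X](_ : _ = (0, y)).
- by congr pair; rewrite /= (addr0, add0r).
- rewrite [in RHS](le' y); elim/big_rec2: _ => // i u v _ ->.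
  by congr pair; rewrite /= addr0.
- rewrite [in RHS](le x); elim/big_rec2: _ => // i u v _ ->.
  by congr pair; rewrite /= addr0.
Qed.

Lemma Ck_comp k V W Z (U : set V) (U' : set W) (f : V -> W) (g : W -> Z) :
  finite_frame W -> finite_frame Z -> open U -> open U' ->
  (forall x, U x -> U' (f x)) -> Ck k U f -> Ck k U' g -> Ck k U (g \o f).
Proof.
move=> [n [e [l [cl le]]]] [p [e' [l' [cl' le']]]] Uo Uo' sU.
(* Scalar targets come first, because the chain rule in a frame produces products and [CkM] is about
   scalar functions. The frame of [Z] then gives the general case. *)
have scalar_comp : forall k (h : W -> R^o), Ck k U f -> Ck k U' h -> Ck k U (h \o f).
  elim=> [|{}k IH] h.
    by move=> cf ch x Ux; apply: continuous_comp; [exact: cf|exact/ch/sU].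
  move=> Cf Ch; have [df Df] := Cf; have [dh Dh] := Ch.
  have dhf x : U x -> differentiable (h \o f) x.
    move=> Ux; apply: (@differentiable_comp _ _ _ _ f h); first exact: df.
    exact/dh/sU.
  split=> // v.
  apply: (@eq_Ck _ _ _ _ _ (fun x => \sum_i ((l i \o 'D_v f) * ('D_(e i) h \o f)) x)) => //.
    move=> x Ux; rewrite [RHS]deriveE; last exact: dhf.
    rewrite (@diff_comp _ _ _ _ f h); [|exact: df|exact/dh/sU].
    rewrite /= -(deriveE _ (df _ Ux)).
    rewrite [in RHS](le ('D_v f x)) linear_sum; apply: eq_bigr => i _.
    by rewrite linearZ /= -deriveE //; exact/dh/sU.
  apply: (@Ck_sum _ _ _ _ _ (fun i => (l i \o 'D_v f) * ('D_(e i) h \o f))) => // i.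
  apply: CkM => //; last by apply: IH; [exact: CkW|exact: Dh].
  by apply: (@Ck_lin_comp _ _ _ _ _ (l i)) => //; exact: Df.
move=> Cf Cg.
have -> : g \o f = (fun x => \sum_i ((l' i \o g) \o f) x *: e' i).
  by apply/funext => x /=; rewrite -le'.
apply: (@Ck_sum _ _ _ _ _ (fun i x => ((l' i \o g) \o f) x *: e' i)) => // i.
apply: CkZl => //; apply: scalar_comp => //.
exact: (@Ck_lin_comp _ _ _ _ _ (l' i)).
Qed.

Lemma Ck_pair k V W Z (U : set V) (f : V -> W) (g : V -> Z) :
  open U -> Ck k U f -> Ck k U g -> Ck k U (fun x => (f x, g x)).
Proof.
move=> Uo; elim: k f g => [|k IH] f g.
  by move=> cf cg x Ux; apply: cvg_pair; [exact: cf|exact: cg].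
case=> df Df [dg Dg]; have dfg x : U x -> differentiable (fun x => (f x, g x)) x.
  by move=> Ux; apply: differentiable_pair; [exact: df|exact: dg].
split=> // v; apply: (eq_Ck Uo) (IH _ _ (Df v) (Dg v)) => x Ux.
rewrite [RHS]deriveE; last exact: dfg.
rewrite diff_pair; [|exact: df|exact: dg].
by rewrite /= -(deriveE _ (df _ Ux)) -(deriveE _ (dg _ Ux)).
Qed.

(** The derivative -(1/f)(1/f) f' is a product of functions that are C^k by induction. *)
Lemma Ck_inv k V (U : set V) (f : V -> R^o) :
  open U -> (forall x, U x -> f x != 0) -> Ck k U f ->
  Ck k U (fun x => (f x)^-1 : R^o).
Proof.
move=> Uo f0; elim: k => [|k IH].
  by move=> cf x Ux; apply: cvgV; [exact: f0|exact: cf].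
move=> Cf; have [df Df] := Cf; split=> [x Ux|v].
  by apply: differentiableV; [exact: df|exact: f0].
have Ci : Ck k U (fun x => (f x)^-1 : R^o) by apply: IH; exact: CkW.
apply: (@eq_Ck _ _ _ _ _ (cst (-1 : R^o) * ((fun x => (f x)^-1 : R^o) *
    ((fun x => (f x)^-1 : R^o) * 'D_v f)))) => // [x Ux|].
  rewrite deriveV; [|exact: f0|exact/diff_derivable/df].
  rewrite !fctE /= expr2 invfM.
  change (-1 * ((f x)^-1 * ((f x)^-1 * 'D_v f x)) =
    - ((f x)^-1 * (f x)^-1) * 'D_v f x).
  by rewrite mulN1r mulNr mulrA.
apply: CkM => //; first exact: Ck_cst.
by apply: CkM => //; apply: CkM => //; exact: Df.
Qed.
End Ck_calculus.

(** * Bump functions *)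

Section bump.
Context {R : realType}.

(** Horner induction with [n] general: the factor 'X of each step is absorbed by raising [n], and
    the constant term is controlled by y^n <= n! e^y. *)
Let poly_expRN_bound (p : {poly R}) n :
  exists2 C : R, 0 <= C & forall y, 0 < y -> `|p.[y]| * y ^+ n * expR (- y) <= C.
Proof.
elim/poly_ind: p n => [|p c IH] n.
  by exists 0 => // y y0; rewrite horner0 normr0 !mul0r.
have [C C0 HC] := IH n.+1.
exists (C + `|c| * (n`!)%:R); first by rewrite addr_ge0 ?mulr_ge0.
move=> y y0; have yn : y ^+ n * expR (- y) <= (n`!)%:R.
  rewrite expRN ler_pdivrMr ?expR_gt0 // mulrC -ler_pdivrMr ?ltr0n ?fact_gt0 //.
  case: n {HC} => [|n]; first by rewrite expr0 divr1 -expR0 ler_expR ltW.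
  by apply: le_trans (expR_ge1Dxn n (ltW y0)); rewrite lerDr.
rewrite hornerMXaddC -mulrA.
apply: le_trans (_ : (`|p.[y] * y| + `|c|) * (y ^+ n * expR (- y)) <= _).
  by apply: ler_wpM2r; [rewrite mulr_ge0 ?exprn_ge0 ?expR_ge0 ?ltW|exact: ler_normD].
rewrite mulrDl lerD //; last by rewrite ler_wpM2l.
apply: le_trans (HC _ y0); rewrite normrM (gtr0_norm y0) exprS !mulrA.
by rewrite -!mulrA.
Qed.

(* This family is stable under derivation, whence [Ck k] by induction on k.    *)
Let flat (p : {poly R}) (x : R^o) : R^o :=
  if 0 < x then p.[x^-1] * expR (- x^-1) else 0.

(** For x > 0 the derivative of p(1/x) e^(-1/x) is x^(-2) (p - p')(1/x) e^(-1/x). *)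
Let flat_deriv (p : {poly R}) : {poly R} := 'X^2 * (p - p^`()).

(** A quadratic bound forces the difference quotients at 0 to tend to 0. It is the previous bound at
    y = 1/x with n = 2. *)
Let flat_bound p : exists2 C : R, 0 <= C & forall x, `|flat p x| <= C * x ^+ 2.
Proof.
have [C C0 HC] := poly_expRN_bound p 2.
exists C => // x; rewrite /flat; case: ifPn => x0; last first.
  by rewrite normr0 mulr_ge0 ?sqr_ge0.
have xi0 : 0 < x^-1 by rewrite invr_gt0.
have x20 : 0 < x ^+ 2 by rewrite exprn_gt0.
rewrite normrM (ger0_norm (expR_ge0 _)).
apply: le_trans (ler_wpM2r (ltW x20) (HC _ xi0)).
have -> : forall a b : R, a * x^-1 ^+ 2 * b * x ^+ 2 = a * b * (x^-1 * x) ^+ 2.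
  by move=> a b; ring.
by rewrite mulVf ?gt_eqF // expr1n mulr1.
Qed.

Let is_derive_flat p (x : R^o) : is_derive x (1 : R^o) (flat p) (flat (flat_deriv p) x).
Proof.
have [x0|x0|->] := ltgtP x 0.
- have -> : flat (flat_deriv p) x = 0 by rewrite /flat ltNge (ltW x0).
  apply: (@near_eq_is_derive R R^o R^o (cst 0)).
  near=> y; rewrite /flat; case: ifPn => // y0.
  have : y < 0 by near: y; exact: (lt_nbhsl x0).
  by rewrite ltNge (ltW y0).
- have -> : flat (flat_deriv p) x =
      p.[x^-1] * expR (- x^-1) * x ^- 2 - p^`().[x^-1] * expR (- x^-1) * x^-2.
    by rewrite /flat x0 /flat_deriv hornerM hornerD hornerN hornerXn exprVn; ring.
  apply: (@near_eq_is_derive R R^o R^o (fun y : R => p.[y^-1] * expR (- y^-1))).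
    near=> y; rewrite /flat ifT //.
    by near: y; exact: (lt_nbhsr x0).
  have xn0 : x != 0 :> R by rewrite gt_eqF.
  have dV : is_derive (x : R) (1 : R) (fun y : R => y^-1) (- x ^- 2).
    by apply: (is_derive_eq (is_deriveV (f := id) xn0 (is_derive_id _ _)));
      rewrite [_ *: _]mulr1.
  have dp := is_derive1_comp (is_derive_poly p x^-1) dV.
  have de := @is_derive1_comp R expR (- (fun y : R => y^-1)) x _ _
    (is_derive_expR (- x^-1)) (is_deriveN dV).
  apply: (is_derive_eq (is_deriveM dp de)).
  rewrite /= -![_ *: _]/(_ * _); ring.
- have f0 q : flat q 0 = 0 by rewrite /flat ltxx.
  have [C C0 HC] := flat_bound p.
  suff cv :
      (fun h : R => h^-1 *: ((flat p \o shift 0) (h *: (1 : R^o)) - flat p 0))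
        @ 0^' --> (0 : R^o).
    apply: DeriveDef; first by apply/cvg_ex; exists 0.
    by rewrite f0; exact/cvg_lim.
  apply/cvgr0Pnorm_le => e e0.
  (* [C] may be 0, hence the denominator [C + 1]. *)
  have eC : 0 < e / (C + 1) by rewrite divr_gt0 // ltr_wpDl.
  near=> h; have hn0 : h != 0 by near: h; exact: nbhs_dnbhs_neq.
  rewrite /= f0 subr0 addr0 [h *: _]mulr1 normrZ normfV ler_pdivrMl ?normr_gt0 //.
  apply: le_trans (HC h) _; rewrite -(real_normK (num_real h)) expr2 mulrA mulrC.
  rewrite ler_wpM2l //; have : `|h| <= e / (C + 1).
    by near: h; exact: dnbhs0_le.
  rewrite ler_pdivlMr ?ltr_wpDl // mulrDr mulr1 mulrC; apply: le_trans.
  by rewrite lerDl.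
Unshelve. all: by end_near. Qed.

Lemma derive_line (V : normedModType R) (f : R^o -> V) (x v : R^o) :
  differentiable f x -> 'D_v f x = v *: 'D_1 f x.
Proof.
by move=> df; rewrite !deriveE // -linearZ; congr ('d f x _); rewrite [_ *: _]mulr1.
Qed.

Let Ck_flat k p : Ck k setT (flat p).
Proof.
have dflat q x : differentiable (flat q) x.
  by apply/derivable1_diffP; case: (is_derive_flat q x).
elim: k p => [|k IH] p; first by move=> x _; exact/differentiable_continuous.
split=> // v; apply: (@eq_Ck _ _ _ _ _ (cst v * flat (flat_deriv p))) => [|x _|].
- exact: openT.
- by rewrite derive_line //; case: (is_derive_flat p x) => _ ->.
- by apply: CkM; [exact: openT|exact: Ck_cst|exact: IH].
Qed.

(** With [a] = 1 - x^2 and [c] = x^2 - 1/4, the bump is flat(a) / (flat(a) + flat(c)), where flat(t)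
    is e^(-1/t) for t > 0 and 0 otherwise. At every point [a] or [c] is positive, so the denominator
    never vanishes; the sign changes at |x| = 1 and |x| = 1/2 give the two radii. *)
Lemma exists_line_bump : exists b : R^o -> R^o,
  [/\ Cinf setT b, forall x, `|x| <= 2^-1 -> b x = 1,
      forall x, 1 <= `|x| -> b x = 0 & forall x, `|b x| <= 1].
Proof.
pose a : R^o -> R^o := fun x => 1 - x * x.
pose c : R^o -> R^o := fun x => x * x - 4^-1.
have Cid k : Ck k [set: R^o] (fun x : R^o => x : R^o) by exact: (@Ck_id R).
have oT : open [set: R^o] by exact: openT.
have Ca k : Ck k setT a.
  apply: (@eq_Ck _ _ _ _ _ (cst (1 : R^o) + cst (- 1 : R^o) * (idfun * idfun))) => //.
    by move=> x _; rewrite !fctE /a /= mulN1r.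
  apply: CkD => //; first exact: Ck_cst.
  by apply: CkM => //; [exact: Ck_cst|exact: CkM].
have Cc k : Ck k setT c.
  apply: (@eq_Ck _ _ _ _ _ (idfun * idfun + cst (- 4^-1 : R^o))) => //.
  by apply: CkD => //; [exact: CkM|exact: Ck_cst].
have flat_ge0 x : 0 <= flat 1 x.
  by rewrite /flat; case: ifP => // _; rewrite hornerC mul1r expR_ge0.
have flat_gt0 x : 0 < x -> 0 < flat 1 x.
  by rewrite /flat => ->; rewrite hornerC mul1r expR_gt0.
have flat_le0 x : x <= 0 -> flat 1 x = 0 by rewrite /flat ltNge => ->.
have Cf k (g : R^o -> R^o) : Ck k setT g -> Ck k setT (flat 1 \o g).
  move=> Cg; apply: (Ck_comp (finite_frame_line (R := R)) (finite_frame_line (R := R)) oT oT) => //.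
pose d : R^o -> R^o := (flat 1 \o a) + (flat 1 \o c).
have d0 x : d x != 0.
  rewrite gt_eqF // /d !fctE /=; have [x1|x1] := ltP (x * x) 1.
    by rewrite ltr_wpDr ?flat_gt0 // subr_gt0.
  rewrite ltr_wpDl ?flat_gt0 // subr_gt0; apply: lt_le_trans x1.
  by rewrite invf_lt1 ?ltr1n.
exists ((flat 1 \o a) * (fun x => (d x)^-1 : R^o)); split=> [k|x x1|x x1|x].
- by apply: CkM => //; [exact: Cf|apply: Ck_inv => //; apply: CkD => //; exact: Cf].
- have xx : x * x <= 4^-1.
    rewrite -expr2 -(real_normK (num_real x)).
    have -> : (4 : R)^-1 = 2^-1 ^+ 2 by field.
    by rewrite ler_pXn2r ?nnegrE ?invr_ge0.
  have dE : d x = flat 1 (a x) by rewrite /d !fctE /= [flat 1 (c x)]flat_le0 ?addr0 // subr_le0.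
  by rewrite !fctE /= dE mulfV // -dE.
- rewrite !fctE /= flat_le0 ?mul0r // /a subr_le0.
  by rewrite -expr2 -(real_normK (num_real x)) exprn_ege1.
- have dx0 : 0 < d x.
    by rewrite lt_neqAle eq_sym d0; exact: (addr_ge0 (flat_ge0 (a x)) (flat_ge0 (c x))).
  rewrite !fctE /= ger0_norm; last by rewrite mulr_ge0 ?invr_ge0 ?(ltW dx0) ?flat_ge0.
  rewrite ler_pdivrMr // mul1r -[X in X <= _]addr0.
  exact: lerD (lexx _) (flat_ge0 (c x)).
Qed.

Lemma Cinf_dilation (b : R^o -> R^o) (x r : R) :
  Cinf setT b -> Cinf setT (fun y => b ((y - x) / r) : R^o).
Proof.
move=> Cb k; have oT : open [set: R^o] by exact: openT.
apply: (@Ck_comp _ k R^o R^o R^o setT setT (fun y : R^o => (y - x) / r : R^o) b) => //;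
  [exact: finite_frame_line|exact: finite_frame_line|].
apply: (@eq_Ck _ _ _ _ _ ((idfun + cst (- x : R^o)) * cst (r^-1 : R^o))) => //.
by apply: CkM => //; [apply: CkD => //; [exact: Ck_id|exact: Ck_cst]|exact: Ck_cst].
Qed.

(** Such a [phi] turns a line in a chart into a curve that is defined for all times, never leaves
    the chart and keeps its velocity at 0. *)
Lemma exists_small_reparametrization (e : R) : 0 < e ->
  exists phi : R^o -> R^o, [/\ Cinf setT phi,
    \forall t \near (0 : R^o), phi t = t & forall t, `|phi t| <= e].
Proof.
move=> e0; have [b [Cb b1 b0 bb]] := exists_line_bump.
exists (idfun * (fun t => b ((t - 0) / e) : R^o)); split=> [k||t].
- by apply: CkM; [exact: openT|exact: Ck_id|exact: Cinf_dilation].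
- have e2 : 0 < e / 2 by rewrite divr_gt0.
  apply: filterS (nbhs0_le e2) => t te; rewrite fctE b1 ?mulr1 //.
  by rewrite subr0 normrM normfV (gtr0_norm e0) ler_pdivrMr // mulrC.
- rewrite fctE normrM; have [te|te] := leP `|t| e.
    by rewrite -[e]mulr1 ler_pM.
  rewrite b0 ?normr0 ?mulr0; first exact: ltW.
  by rewrite subr0 normrM normfV (gtr0_norm e0) ler_pdivlMr // mul1r ltW.
Qed.

Lemma rV_norm_le n (u : 'rV[R]_n) (e : R) : 0 <= e ->
  (`|u| <= e) = [forall i, `|u 0 i| <= e].
Proof.
move=> e0; apply/idP/forallP => [ue i|ue]; rewrite /Num.norm /= mx_normrE in ue *.
  by have /bigmax_leP[_ /(_ (0, i))] := ue; exact.
by apply/bigmax_leP; split=> // -[i j] _; rewrite (ord1 i); exact: ue.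
Qed.

(** The norm is the sup norm, so its balls are cubes and a product of one-variable bumps is
    supported in one. The support is enclosed in a compact set because its image in a Hausdorff
    manifold is then closed, which permits extension by zero. *)
Lemma exists_rV_bump n (u0 : 'rV[R]_n) (U : set 'rV[R]_n) : nbhs u0 U ->
  exists (b : 'rV[R]_n -> R^o) (K : set 'rV[R]_n),
    [/\ Cinf setT b, \forall u \near u0, b u = 1, compact K, K `<=` U
      & forall u, ~ K u -> b u = 0].
Proof.
move=> /nbhs_ballP[e /= e0 eU]; have [b [Cb b1 b0 bb]] := exists_line_bump.
have r0 : 0 < e / 2 by rewrite divr_gt0.
set r := e / 2 in r0; have oT : open [set: 'rV[R]_n] by exact: openT.
pose c i (u : 'rV[R]_n) : R^o := b ((u 0 i - u0 0 i) / r).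
have Cc i : Cinf setT (c i).
  move=> k; have lin_coord : linear (fun v : 'rV[R]_n => v 0 i : R^o).
    by move=> a u v; rewrite !mxE.
  pose l : {linear 'rV[R]_n -> R^o} := HB.pack (fun v : 'rV[R]_n => v 0 i : R^o)
    (GRing.isLinear.Build _ _ _ _ _ lin_coord).
  apply: (@Ck_comp _ k 'rV[R]_n R^o R^o setT setT l
      (fun y => b ((y - u0 0 i) / r) : R^o)) => //.
  - exact: finite_frame_line.
  - exact: finite_frame_line.
  - exact: openT.
  - by apply: Ck_lin => //; exact: coord_continuous.
  - exact: Cinf_dilation.
exists (\prod_i c i), [set u | `|u - u0| <= r]; split=> [k|||u ur|u /negP].
- by elim/big_ind: _ => [|f g Cf Cg|i _];
    [exact: (@Ck_cst _ _ _ _ _ (1 : R^o))|exact: CkM|exact: Cc].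
- have r2 : 0 < r / 2 by rewrite divr_gt0.
  near=> u; rewrite fct_prodE big1 // => i _; rewrite /c b1 //.
  have : `|u - u0| <= r / 2.
    near: u; apply: filterS (nbhsx_ballx u0 _ r2) => v.
    by rewrite -ball_normE /= distrC => /ltW.
  rewrite (rV_norm_le _ (ltW r2)) => /forallP/(_ i); rewrite !mxE => ui.
  by rewrite normrM normfV (gtr0_norm r0) ler_pdivrMr // (mulrC _ r).
- apply: bounded_closed_compact.
    exists (r + `|u0|); split; first exact: num_real.
    move=> M rM u /= ur; apply: ltW; apply: le_lt_trans rM.
    by rewrite -[u](subrK u0); apply: le_trans (ler_normD _ _) _; rewrite lerD2r.
  rewrite (_ : [set _ | _] = closed_ball u0 r); first exact: closed_ball_closed.
  by rewrite closed_ballE //; apply/seteqP; split=> u /=; rewrite /closed_ball_ /= distrC.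
- apply: eU; rewrite -ball_normE /= distrC; apply: le_lt_trans ur _.
  by rewrite /r ltr_pdivrMr // ltr_pMr // ltr1n.
- rewrite (rV_norm_le _ (ltW r0)) negb_forall => /existsP[i]; rewrite -ltNge !mxE => ri.
  rewrite fct_prodE (bigD1 i) //= [c i u]b0 ?mul0r //.
  by rewrite normrM normfV (gtr0_norm r0) ler_pdivlMr // mul1r ltW.
Unshelve. all: by end_near. Qed.
End bump.

(** * Hadamard's lemma *)

Section mean.
Context {R : realType}.

(** [I] is the Lebesgue integral over [0, 1]. Additivity, homogeneity, the norm bound and the
    fundamental theorem of calculus are all that Hadamard's lemma takes from integration. *)
Lemma exists_mean : exists I : (R -> R) -> R,
  [/\ forall f g : R -> R, continuous f -> continuous g ->
        I (fun t => f t + g t) = I f + I g,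
      forall a (f : R -> R), continuous f -> I (fun t => a * f t) = a * I f,
      forall (f : R -> R) (C : R), continuous f -> (forall t, 0 <= t <= 1 -> `|f t| <= C) ->
        `|I f| <= C
    & forall F F' : R -> R, (forall t : R, is_derive t 1 F (F' t)) -> continuous F' ->
        I F' = F 1 - F 0].
Proof.
have int01 (f : R -> R) : continuous f -> (@lebesgue_measure R).-integrable `[0, 1] (EFin \o f).
  move=> cf; apply: continuous_compact_integrable; first exact: segment_compact.
  exact: continuous_subspaceT.
exists (fun f => (\int[@lebesgue_measure R]_(t in `[0, 1]) f t)%R); split.
- by move=> f g cf cg; rewrite RintegralD //; exact: int01.
- by move=> a f cf; rewrite RintegralZl //; exact: int01.
- move=> f C cf fC.
  have cnf : continuous (fun t => `|f t|).
    by move=> t; apply: continuous_comp; [exact: cf|exact: norm_continuous].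
  apply: le_trans (le_normr_Rintegral _ (int01 _ cf)) _; first exact: measurable_itv.
  apply: (@le_trans _ _ (\int[@lebesgue_measure R]_(t in `[0, 1]) (cst C t))%R).
    apply: le_Rintegral => //; [exact: int01|].
    by apply: int01; exact: cst_continuous.
  by rewrite Rintegral_cst //= lebesgue_measure_itv /= lte_fin ltr01 /= subr0 mulr1.
- move=> F F' dF cF'.
  have cF : continuous F.
    move=> t; apply/differentiable_continuous/derivable1_diffP.
    by case: (dF t).
  rewrite /Rintegral (@continuous_FTC2 R F' F) ?ltr01 //.
  + exact: continuous_subspaceT.
  + split=> [t _||]; first by case: (dF t).
    * exact/cvg_at_right_filter/cF.
    * exact/cvg_at_left_filter/cF.
  + by move=> t _; rewrite derive1E; case: (dF t).
Qed.
End mean.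

Section hadamard.
Context {R : realType} (n : nat).
Local Notation E := ('rV[R]_n).

Let ray (u0 u : E) (t : R) : E := t *: (u - u0) + u0.

Lemma derive_sum_partial (f : E -> R^o) u v : differentiable f u ->
  'D_v f u = \sum_i v 0 i * 'D_(delta_mx 0 i) f u.
Proof.
move=> df; rewrite deriveE // {1}[v]row_sum_delta linear_sum.
by apply: eq_bigr => i _; rewrite linearZ /= -deriveE.
Qed.

Lemma is_derive_line (f : E -> R^o) (y k : E) (s : R) :
  differentiable f (y + s *: k) ->
  is_derive s (1 : R) (fun s : R => f (y + s *: k) : R) ('D_k f (y + s *: k)).
Proof.
move=> df.
have dl : is_diff s (fun s : R => y + s *: k) (fun s => s *: k).
  by apply: is_diff_eq; apply/funext => ? /=; rewrite !fctE add0r.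
have ds : differentiable (fun s : R => f (y + s *: k) : R) s.
  apply: (@differentiable_comp _ _ _ _ (fun s : R => y + s *: k) f);
    [exact: ex_diff|exact: df].
apply: DeriveDef; first exact: diff_derivable.
rewrite deriveE // (@diff_comp _ _ _ _ (fun s : R => y + s *: k) f) //.
by rewrite /= diff_val scale1r -deriveE.
Qed.

Let continuous_ray (u0 u : E) : continuous (ray u0 u).
Proof.
move=> t; apply: cvgD; last exact: cvg_cst.
by apply: cvgZr_tmp; exact: cvg_id.
Qed.

(** Continuity at each (t, 0) gives a neighbourhood of [h] = 0, and compactness of [0, 1] makes it
    independent of [t]. *)
Let partial_uniform (g : E -> R^o) (u0 u : E) (e : R) : continuous g -> 0 < e ->
  \forall h \near (0 : E), forall t, 0 <= t <= 1 ->
    `|g (ray u0 u t + h) - g (ray u0 u t)| <= e.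
Proof.
move=> cg e0; have /compact_near_coveringP := @segment_compact R 0 1.
move=> /(_ E (nbhs (0 : E)) (fun h t => `|g (ray u0 u t + h) - g (ray u0 u t)| <= e)).
have cphi : continuous (fun z : R * E => g (ray u0 u z.1 + z.2) - g (ray u0 u z.1)).
  move=> z; have cr : {for z, continuous (fun z : R * E => ray u0 u z.1)}.
    by apply: (@continuous_comp _ _ _ fst (ray u0 u)); [exact: cvg_fst|exact: continuous_ray].
  apply: cvgB; last first.
    by apply: (@continuous_comp _ _ _ (fun z : R * E => ray u0 u z.1) g);
      [exact: cr|exact: cg].
  apply: (@continuous_comp _ _ _ (fun z : R * E => ray u0 u z.1 + z.2) g); last exact: cg.
  by apply: cvgD; [exact: cr|exact: cvg_snd].
move=> H; apply: filterS (H _ _) => [h Hh t t01|t _].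
  by apply: Hh; rewrite /= in_itv.
have := cphi (t, 0); rewrite /continuous_at /= addr0 subrr => /cvgr0Pnorm_le.
by move=> /(_ e e0).
Qed.

(** A first-order expansion uniform in [t], prepared for differentiation under the integral sign.
    The mean value theorem on the segment from [ray u0 u t] to [ray u0 (u + h) t], whose direction
    is [t *: h], leaves only oscillations of partial derivatives, small by [partial_uniform]. *)
Let expansion (f : E -> R^o) (u0 u : E) (e : R) : Ck 1 setT f -> 0 < e ->
  \forall h \near (0 : E), forall t, 0 <= t <= 1 ->
    `|f (ray u0 (u + h) t) - f (ray u0 u t)
      - \sum_i h 0 i * (t * 'D_(delta_mx 0 i) f (ray u0 u t))| <= e * `|h|.
Proof.
(* Each of the [n] partial derivatives may contribute [d] times the norm of [h]; dividing by [n.+1]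
   avoids division by zero. *)
move=> [df Df] e0; pose d := e / n.+1%:R.
have d0 : 0 < d by rewrite divr_gt0.
have Hi i : \forall h \near (0 : E), forall t, 0 <= t <= 1 ->
    `|'D_(delta_mx 0 i) f (ray u0 u t + h) - 'D_(delta_mx 0 i) f (ray u0 u t)| <= d.
  by apply: (partial_uniform (g := 'D_(delta_mx 0 i) f)) => // x; exact: Df.
have [r /= r0 Hr] := (nbhs_ballP _ _).1 (@filter_forall _ _ _ (nbhs (0 : E)) _ Hi).
apply/(nbhs_ballP (0 : E)); exists r => // h hr t t01.
have hr' : `|h| < r by move: hr; rewrite -ball_normE /= sub0r normrN.
have [t0 t1] := andP t01.
set y := ray u0 u t; have -> : ray u0 (u + h) t = y + t *: h.
  by rewrite /y /ray addrAC scalerDr addrAC.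
pose psi (s : R) : R := f (y + s *: (t *: h)).
have dpsi (s : R) : is_derive s (1 : R) psi ('D_(t *: h) f (y + s *: (t *: h))).
  by apply: is_derive_line; exact: df.
have [|s s01] := @MVT_segment R psi (fun s => 'D_(t *: h) f (y + s *: (t *: h)))
  0 1 ler01 (fun s _ => dpsi s).
  apply: continuous_subspaceT => s; apply/differentiable_continuous/derivable1_diffP.
  by case: (dpsi s).
rewrite /psi scale1r scale0r addr0 subr0 mulr1 => ->.
rewrite derive_sum_partial; last exact: df.
rewrite -sumrB; apply: le_trans (ler_norm_sum _ _ _) _.
have hh : forall i, `|h 0 i| <= `|h|.
  by move=> i; have := lexx `|h|; rewrite {1}rV_norm_le // => /forallP.
apply: le_trans (_ : \sum_(i < n) `|h| * d <= _); last first.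
  rewrite sumr_const card_ord -mulr_natl mulrCA mulrC ler_wpM2r //.
  by rewrite /d mulrCA -[X in _ <= X]mulr1 ler_wpM2l ?(ltW e0) // ler_pdivrMr // mul1r ler_nat.
apply: ler_sum => i _; rewrite mxE -mulrA mulrCA -mulrBr -mulrBr !normrM.
have := s01; rewrite in_itv /= => /andP[s0 s1].
rewrite (ger0_norm t0) ler_pM ?mulr_ge0 //.
rewrite -[d]mul1r ler_pM //; apply: Hr => //.
rewrite -ball_normE /= sub0r normrN !normrZ (ger0_norm s0) (ger0_norm t0).
apply: le_lt_trans hr'; rewrite mulrA -[X in _ <= X]mul1r ler_wpM2r //.
by rewrite mulr_ile1.
Qed.
(** The difference f(u) - f(u0) is the integral of the derivative of t -> f(u0 + t(u - u0)) over
    [0, 1]. Expanding this derivative in partial derivatives shows that [g i] must be the integral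
    of the i-th one along the ray. *)
Lemma hadamard (f : E -> R^o) (u0 : E) : Cinf setT f ->
  exists g : 'I_n -> E -> R^o,
    [/\ forall i, Cinf setT (g i),
        forall i, g i u0 = 'D_(delta_mx 0 i) f u0
      & forall u, f u = f u0 + \sum_i (u 0 i - u0 0 i) * g i u].
Proof.
have [I [ID IZ IB IF]] := @exists_mean R.
have IN g : continuous g -> I (fun t => - g t) = - I g.
  by move=> cg; rewrite -mulN1r -IZ //; congr I; apply/funext => t; rewrite mulN1r.
have I0 : I (fun=> 0) = 0.
  rewrite -[RHS](mul0r (I (fun=> 0))) -IZ; last exact: cst_continuous.
  by congr I; apply/funext => t; rewrite mul0r.
have Isum (g : 'I_n -> R -> R) : (forall i, continuous (g i)) ->
    I (fun t => \sum_i g i t) = \sum_i I (g i).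
  move=> cg; suff [] : I (fun t => \sum_i g i t) = \sum_i I (g i) /\
      continuous (fun t => \sum_i g i t) by [].
  have -> : (fun t => \sum_i g i t) = \sum_i g i by apply/funext => t; rewrite fct_sumE.
  elim/big_ind2: _ => [|x1 x2 y1 y2 [<- cx] [<- cy]|i _]; last by [].
    by split; [exact: I0|exact: cst_continuous].
  by split; [exact: ID|move=> t; apply: cvgD; [exact: cx|exact: cy]].
(* [D_v (J k g) = J k.+1 (D_v g)]: this family is stable under derivation too. *)
pose J k (g : E -> R^o) (u : E) : R^o := I (fun t => t ^+ k * g (ray u0 u t)).
have cJ k (g : E -> R^o) u : continuous g ->
    continuous ((fun t => t ^+ k * g (ray u0 u t)) : R -> R).
  move=> cg t; apply: cvgM; first exact: exprn_continuous.
  by apply: (@continuous_comp _ _ _ (ray u0 u) g); [exact: continuous_ray|exact: cg].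
have dJ k (g : E -> R^o) u : Ck 1 setT g -> differentiable (J k g) u /\
    forall v, 'D_v (J k g) u = J k.+1 ('D_v g) u.
  move=> C1g; have [dg Dg] := C1g.
  have cg : continuous g by move=> x; exact/differentiable_continuous/dg.
  have cDg v : continuous ('D_v g) by move=> x; exact: Dg.
  pose L (h : E) : R^o := \sum_i h 0 i * J k.+1 ('D_(delta_mx 0 i) g) u.
  have linL : linear L.
    move=> a x y; rewrite /L scaler_sumr -big_split; apply: eq_bigr => i _.
    by rewrite !mxE mulrDl -mulrA.
  pose dL : {linear E -> R^o} := HB.pack L (GRing.isLinear.Build _ _ _ _ _ linL).
  have cL : continuous dL.
    move=> x; rewrite /dL /= /L.
    rewrite (_ : (fun h : E => _) = \sum_i (fun h : E => h 0 i * J k.+1 ('D_(delta_mx 0 i) g) u)).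
      apply/differentiable_continuous/differentiable_sum => i.
      apply: differentiableM => //; exact: differentiable_coord.
    by apply/funext => h; rewrite fct_sumE.
  have cL1 v i : continuous
      ((fun t => v 0 i * (t ^+ k.+1 * 'D_(delta_mx 0 i) g (ray u0 u t))) : R -> R).
    by move=> t; apply: cvgM; [exact: cvg_cst|exact: (cJ _ ('D_(delta_mx 0 i) g))].
  have LI (v : E) : L v =
      I (fun t => \sum_i v 0 i * (t ^+ k.+1 * 'D_(delta_mx 0 i) g (ray u0 u t))).
    rewrite Isum; last exact: cL1.
    by apply: eq_bigr => i _; rewrite IZ //; exact: (cJ _ ('D_(delta_mx 0 i) g)).
  have LE v : L v = J k.+1 ('D_v g) u.
    rewrite LI /J; congr I; apply/funext => t.
    rewrite (derive_sum_partial v); last exact: dg.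
    by rewrite mulr_sumr; apply: eq_bigr => i _; rewrite mulrCA.
  (* Differentiation under the integral sign: the remainder [r] is at most e times the norm of [h],
     uniformly in [t] since t^k <= 1, and [I] preserves this bound. *)
  have expJ : J k g \o shift u = cst (J k g u) + (dL : E -> R^o) +o_ 0 id.
    apply/eqaddoP => e e0.
    apply: filterS (expansion u0 u C1g e0) => h Hh.
    pose S t : R := \sum_i h 0 i * (t ^+ k.+1 * 'D_(delta_mx 0 i) g (ray u0 u t)).
    have cS : continuous S.
      rewrite (_ : S = \sum_i (fun t => h 0 i * (t ^+ k.+1 * 'D_(delta_mx 0 i) g (ray u0 u t)))).
        by elim/big_ind: _ => [|x y cx cy|i _];
          [exact: cst_continuous|move=> t; apply: cvgD; [exact: cx|exact: cy]|exact: cL1].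
      by apply/funext => t; rewrite fct_sumE.
    pose r t : R := t ^+ k * g (ray u0 (u + h) t) - t ^+ k * g (ray u0 u t) - S t.
    have cr : continuous r.
      by move=> t; apply: cvgB; [apply: cvgB; exact: cJ|exact: cS].
    have -> : (J k g \o shift u - (cst (J k g u) + (dL : E -> R^o))) h = I r.
      rewrite !fctE /= [h + u]addrC; apply/eqP; rewrite subr_eq; apply/eqP.
      change (J k g (u + h) = I r + (J k g u + L h)).
      rewrite LI /J; pose B t : R := t ^+ k * g (ray u0 u t).
      have cB : continuous B by exact: cJ.
      rewrite -(ID B S) // -(ID r (fun t => B t + S t)) //; last first.
        by move=> t; apply: cvgD; [exact: cB|exact: cS].
      by congr I; apply/funext => t; rewrite /r /B; ring.
    apply: IB => // t t01.
    have -> : r t = t ^+ k * (g (ray u0 (u + h) t) - g (ray u0 u t)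
        - \sum_i h 0 i * (t * 'D_(delta_mx 0 i) g (ray u0 u t))).
      rewrite /r !mulrBr; congr (_ - _); rewrite mulr_sumr; apply: eq_bigr => i _.
      by rewrite exprSr [RHS]mulrCA !mulrA.
    have /andP[t0 t1] := t01.
    rewrite normrM -[X in _ <= X]mul1r ler_pM //; last exact: Hh.
    by rewrite ger0_norm ?exprn_ge0 // exprn_ile1.
  have dJE := diff_unique cL expJ.
  have dJu : differentiable (J k g) u by apply/diff_locallyP; rewrite dJE.
  by split=> // v; rewrite deriveE // dJE.
have CJ m k (g : E -> R^o) : Cinf setT g -> Ck m setT (J k g).
  elim: m k g => [|m IH] k g Cg.
    move=> u _; apply: differentiable_continuous; exact: (dJ k g u (Cg 1)).1.
  split=> [u _|v]; first exact: (dJ k g u (Cg 1)).1.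
  have -> : 'D_v (J k g) = J k.+1 ('D_v g) by apply/funext => u; rewrite (dJ k g u (Cg 1)).2.
  by apply: IH => p; case: (Cg p.+1) => _; exact.
move=> Cf; exists (fun i => J 0 ('D_(delta_mx 0 i) f)); split=> [i p|i|u].
- by apply: CJ => q; case: (Cf q.+1) => _; exact.
(* The mean of the constant 1 is 1, by the fundamental theorem applied to the identity. *)
- have dId (t : R) : is_derive t (1 : R) (id : R -> R) 1 by exact: is_derive_id.
  rewrite /J; set a := 'D_(delta_mx 0 i) f u0.
  transitivity (I (fun t => a * 1)).
    congr I; apply/funext => t.
    by rewrite /ray subrr scaler0 add0r expr0 mul1r mulr1.
  rewrite IZ; last exact: cst_continuous.
  by rewrite (IF _ _ dId) ?subr0 ?mulr1 //; exact: cst_continuous.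
have [df Df] := Cf 1.
have cDf v : continuous ('D_v f) by move=> x; exact: Df.
have cr i : continuous ((fun t => 'D_(delta_mx 0 i) f (ray u0 u t)) : R -> R).
  move=> t; apply: (@continuous_comp _ _ _ (ray u0 u) ('D_(delta_mx 0 i) f)).
    exact: continuous_ray.
  exact: cDf.
have cr' i : continuous ((fun t => (u 0 i - u0 0 i) * 'D_(delta_mx 0 i) f (ray u0 u t)) : R -> R).
  by move=> t; apply: cvgM; [exact: cvg_cst|exact: cr].
pose S t : R := \sum_i (u 0 i - u0 0 i) * 'D_(delta_mx 0 i) f (ray u0 u t).
have cS : continuous S.
  rewrite (_ : S = \sum_i (fun t => (u 0 i - u0 0 i) * 'D_(delta_mx 0 i) f (ray u0 u t))).
    by elim/big_ind: _ => [|x y cx cy|i _];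
      [exact: cst_continuous|move=> t; apply: cvgD; [exact: cx|exact: cy]|exact: cr'].
  by apply/funext => t; rewrite fct_sumE.
have dF (t : R) : is_derive t (1 : R) (fun t : R => f (u0 + t *: (u - u0)) : R) (S t).
  have := is_derive_line (df (u0 + t *: (u - u0)) Logic.I).
  rewrite derive_sum_partial; last exact: df.
  by rewrite /S /ray [u0 + _]addrC; under eq_bigr do rewrite !mxE.
transitivity (f u0 + I S).
  rewrite (IF _ _ dF cS) scale1r scale0r addr0.
  by rewrite addrCA subrr addr0 addrCA subrr addr0.
congr (_ + _); rewrite Isum //; apply: eq_bigr => i _.
by rewrite IZ // /J; congr (_ * I _); apply/funext => t; rewrite expr0 mul1r.
Qed.
End hadamard.

(** * Smooth maps *)

Lemma open_setI_preimage (T U : topologicalType) (W : set T) (V : set U)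
    (f : T -> U) : open W -> (forall x, W x -> {for x, continuous f}) ->
  open V -> open (W `&` f @^-1` V).
Proof.
rewrite !openE => Wo cf Vo x [Wx Vfx]; apply: filterI; first exact: Wo.
by apply: cf => //; exact: Vo.
Qed.

Section smooth_maps.
Context {R : realType}.

Section one_map.
Context {E F : normedModType R} {M : atlasType E} {N : atlasType F}.
Implicit Types (f g : M -> N) (W : set M).

Lemma smooth_on_sub W W' f : W' `<=` W -> smooth_on W f -> smooth_on W' f.
Proof.
move=> sW [cf Cf]; split=> [x /sW|c d cA dA k]; first exact: cf.
apply: Ck_sub (Cf c d cA dA k) => _ [x [[cx Wx] dx] <-].
by exists x => //; split=> //; split=> //; exact: sW.
Qed.

Lemma smooth_on_cover W f :
  (forall x, W x -> exists2 W', W' x & smooth_on W' f) -> smooth_on W f.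
Proof.
move=> Wf; split=> [x /Wf[W' W'x [cf _]]|c d cA dA k]; first exact: cf.
pose D := [set V | smooth_on V f].
apply: (@Ck_sub _ _ _ _ (\bigcup_(V in D)
    (chart_map c @` (chart_dom c `&` V `&` f @^-1` chart_dom d)))).
  move=> _ [x [[cx Wx] dx] <-]; have [W' W'x fW'] := Wf _ Wx.
  by exists W' => //; exists x.
by apply: Ck_bigcup => V [_ Vf]; exact: Vf.
Qed.

Lemma open_chart_setI W f (c : chart M E) (d : chart N F) :
  open W -> (forall x, W x -> {for x, continuous f}) -> atlas c -> atlas d ->
  open (chart_map c @` (chart_dom c `&` W `&` f @^-1` chart_dom d)).
Proof.
move=> Wo cf cA dA; rewrite -setIA; apply: open_chart_img; first exact: atlas_chart.
by apply: open_setI_preimage => //; have [] := atlas_chart _ dA.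
Qed.

Lemma eq_smooth_on W f g : open W -> (forall x, W x -> f x = g x) ->
  smooth_on W f -> smooth_on W g.
Proof.
move=> Wo fg [cf Cf]; have cg x : W x -> {for x, continuous g}.
  move=> Wx; rewrite /prop_for /continuous_at -(fg _ Wx).
  apply: cvg_trans (cf _ Wx); apply: near_eq_cvg.
  near=> y; rewrite fg //; near: y; exact: open_nbhs_nbhs.
split=> // c d cA dA k.
have [_ _ cK _ _] := atlas_chart _ cA.
apply: (@eq_Ck _ _ _ _ _ (chart_map d \o f \o chart_inv c)).
- exact: open_chart_setI.
- by move=> _ [x [[cx Wx] dx] <-] /=; rewrite cK // fg.
- apply: Ck_sub (Cf c d cA dA k) => _ [x [[cx Wx] dx] <-].
  by exists x => //; split=> //=; rewrite fg.
Unshelve. all: by end_near. Qed.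

Lemma smooth_smooth_on W f : smooth f -> smooth_on W f.
Proof. by apply: smooth_on_sub. Qed.

Lemma smooth_on_cst W (y : N) : open W -> smooth_on W (fun _ : M => y).
Proof.
move=> Wo; split=> [x _|c d cA dA k]; first exact: cvg_cst.
exact: (@Ck_cst _ k _ _ _ (chart_map d y)).
Qed.

(** Smoothness is required in all pairs of charts; one pair suffices because the transition maps on
    both sides are smooth. *)
Lemma smooth_into_chart (U : set M) (c : chart M E) (d : chart N F) (h : E -> F) :
  finite_frame E -> finite_frame F -> open U -> U `<=` chart_dom c ->
  atlas c -> atlas d ->
  (forall x, U x -> chart_img d (h (chart_map c x))) ->
  Cinf (chart_map c @` U) h -> smooth_on U (chart_inv d \o h \o chart_map c).
Proof.
move=> fE fF Uo Uc cA dA hd Ch.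
have [cdo cio cK cc ci] := atlas_chart _ cA.
have [ddo dio dK dc di] := atlas_chart _ dA.
have imUo : open (chart_map c @` U).
  by have := open_chart_img (atlas_chart _ cA) Uo; rewrite setIidr.
have cont x : U x -> {for x, continuous (chart_inv d \o h \o chart_map c)}.
  move=> Ux; apply: (@continuous_comp _ _ _ (h \o chart_map c) (chart_inv d)); last first.
    by apply: di; exact: hd.
  apply: (@continuous_comp _ _ _ (chart_map c) h); first by apply: cc; exact: Uc.
  by apply: (Ch 0); exists x.
split=> // c' d' c'A d'A k.
have [c'do c'io c'K c'c c'i] := atlas_chart _ c'A.
have Vo : open (chart_map c' @` (chart_dom c' `&` U `&`
    (chart_inv d \o h \o chart_map c) @^-1` chart_dom d')).
  exact: open_chart_setI.
apply: (@eq_Ck _ _ _ _ _ ((chart_map d' \o chart_inv d) \o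
    (h \o (chart_map c \o chart_inv c')))) => //.
apply: (@Ck_comp _ _ _ _ _ _ (chart_map d @` (chart_dom d `&` chart_dom d'))) => //.
- by apply: open_chart_img; [exact: atlas_chart|have [] := atlas_chart _ d'A].
- move=> _ [x [[c'x Ux] /= d'x] <-]; rewrite /= c'K //.
  have [y dy yE] := hd _ Ux; exists y => //; split=> //.
  by rewrite -yE dK // in d'x.
- apply: (@Ck_comp _ _ _ _ _ _ (chart_map c @` U)) => //.
    by move=> _ [x [[c'x Ux] /= d'x] <-]; rewrite /= c'K //; exists x.
  have := atlas_compat _ _ c'A cA k; apply: Ck_sub => _ [x [[c'x Ux] _] <-].
  by exists x => //; split=> //; exact: Uc.
- exact: atlas_compat.
Qed.
End one_map.

Lemma smooth_on_comp {E F Z : normedModType R} {M : atlasType E}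
    {N : atlasType F} {P : atlasType Z} (W : set M) (V : set N)
    (f : M -> N) (g : N -> P) :
  finite_frame F -> finite_frame Z -> open W -> open V ->
  (forall x, W x -> V (f x)) -> smooth_on W f -> smooth_on V g ->
  smooth_on W (g \o f).
Proof.
move=> fF fZ Wo Vo WV sf sg; have [cf Cf] := sf; have [cg Cg] := sg.
have cgf x : W x -> {for x, continuous (g \o f)}.
  by move=> Wx; apply: continuous_comp; [exact: cf|exact/cg/WV].
split=> // c d cA dA k.
have [cdo cio cK cc ci] := atlas_chart _ cA.
(* The part of the source that [f] sends into the chart [e]: there the composite factors through the
   coordinates of [e], and these parts cover the source. *)
pose S (e : chart N F) := chart_map c @` (chart_dom c `&` W `&`
  f @^-1` (chart_dom e `&` V `&` g @^-1` chart_dom d)).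
have Se e : atlas e -> Ck k (S e) (chart_map d \o (g \o f) \o chart_inv c).
  move=> eA; have [edo eio eK ec ei] := atlas_chart _ eA.
  have So : open (S e).
    rewrite /S -setIA; apply: open_chart_img; first exact: atlas_chart.
    apply: open_setI_preimage => //; rewrite -setIA; apply: openI => //.
    by apply: open_setI_preimage => //; have [] := atlas_chart _ dA.
  apply: (@eq_Ck _ _ _ _ _ ((chart_map d \o g \o chart_inv e) \o
      (chart_map e \o f \o chart_inv c))) => //.
    by move=> _ [x [[cx Wx] [[/= ex Vx] dx]] <-] /=; rewrite cK // eK.
  apply: (@Ck_comp _ _ _ _ _ _
      (chart_map e @` (chart_dom e `&` V `&` g @^-1` chart_dom d))) => //.
  - exact: open_chart_setI.
  - move=> _ [x [[cx Wx] [[/= ex Vx] dx]] <-] /=; rewrite cK //.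
    by exists (f x).
  - apply: Ck_sub (Cf c e cA eA k) => _ [x [[cx Wx] [[/= ex Vx] dx]] <-].
    by exists x.
  - exact: Cg.
apply: (@Ck_sub _ _ _ _ (\bigcup_(e in (@atlas _ _ N)) S e)); last first.
  by apply: Ck_bigcup => e; exact: Se.
move=> _ [x [[cx Wx] /= dx] <-]; have [e eA ex] := atlas_cover (f x).
by exists e => //; exists x => //; split=> //; split=> //; split=> //; exact: WV.
Qed.

Lemma smooth_comp {E F Z : normedModType R} {M : atlasType E}
    {N : atlasType F} {P : atlasType Z} (f : M -> N) (g : N -> P) :
  finite_frame F -> finite_frame Z -> smooth f -> smooth g -> smooth (g \o f).
Proof.
move=> fF fZ sf sg.
by apply: (smooth_on_comp (V := setT)) => //; exact: openT.
Qed.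

Lemma smooth_on_pair {E F Z : normedModType R} {M : atlasType E}
    {N : atlasType F} {P : atlasType Z} (W : set M) (f : M -> N) (g : M -> P) :
  open W -> smooth_on W f -> smooth_on W g ->
  smooth_on W (fun x => (f x, g x) : (N * P)%type).
Proof.
move=> Wo sf sg; have [cf Cf] := sf; have [cg Cg] := sg.
have cfg x : W x -> {for x, continuous (fun x => (f x, g x))}.
  by move=> Wx; apply: cvg_pair; [exact: cf|exact: cg].
split=> // c d cA dA k; have := dA; move=> [[d1 d2] [/= d1A d2A] dE].
have := open_chart_setI Wo cfg cA dA.
rewrite -dE => Vo; apply: (@Ck_pair _ _ _ _ _ _
  (chart_map d1 \o f \o chart_inv c) (chart_map d2 \o g \o chart_inv c)) => //.
- apply: Ck_sub (Cf c d1 cA d1A k) => _ [x [[cx Wx] [/= d1x d2x]] <-].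
  by exists x.
- apply: Ck_sub (Cg c d2 cA d2A k) => _ [x [[cx Wx] [/= d1x d2x]] <-].
  by exists x.
Qed.

Lemma smooth_prod_map {E E' F F' : normedModType R} {M : atlasType E}
    {M' : atlasType E'} {N : atlasType F} {N' : atlasType F'}
    (f : M -> N) (g : M' -> N') : smooth f -> smooth g ->
  smooth (fun z : (M * M')%type => (f z.1, g z.2) : (N * N')%type).
Proof.
move=> [cf Cf] [cg Cg]; split=> [z _|].
  apply: cvg_pair.
    by apply: (@continuous_comp _ _ _ fst f); [exact: cvg_fst|exact: cf].
  by apply: (@continuous_comp _ _ _ snd g); [exact: cvg_snd|exact: cg].
move=> _ _ [[c1 c2] [/= c1A c2A] <-] [[d1 d2] [/= d1A d2A] <-] k.
have cf' x : setT x -> {for x, continuous f} by exact: cf.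
have cg' x : setT x -> {for x, continuous g} by exact: cg.
have := @Ck_prod_map _ k _ _ _ _ _ _ _ _ (open_chart_setI openT cf' c1A d1A)
  (open_chart_setI openT cg' c2A d2A) (Cf _ _ c1A d1A k) (Cg _ _ c2A d2A k).
apply: Ck_sub => _ [[x y] [[/= [c1x c2y] _] [/= d1x d2y]] <-].
by split; [exists x|exists y].
Qed.

Section real_valued.
Context {E : normedModType R} {M : atlasType E}.
Implicit Types (f g : M -> R^o) (W : set M).

Lemma smooth_onP W f : smooth_on W f <->
  (forall x, W x -> {for x, continuous f}) /\
  forall c : chart M E, atlas c ->
    Cinf (chart_map c @` (chart_dom c `&` W)) (f \o chart_inv c).
Proof.
split=> -[cf Cf]; split=> //.
  move=> c cA k; have := Cf c line_chart cA erefl k.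
  by rewrite preimage_setT setIT.
by move=> c d cA -> k; rewrite preimage_setT setIT; exact: Cf.
Qed.

Lemma smooth_onM W f g : open W ->
  smooth_on W f -> smooth_on W g -> smooth_on W (f * g).
Proof.
move=> Wo /smooth_onP[cf Cf] /smooth_onP[cg Cg]; apply/smooth_onP.
split=> [x Wx|c cA k]; first by apply: cvgM; [exact: cf|exact: cg].
apply: (@CkM _ _ _ _ (f \o chart_inv c) (g \o chart_inv c)).
- by apply: open_chart_img => //; exact: atlas_chart.
- exact: Cf.
- exact: Cg.
Qed.

Lemma smooth_on_chart (c : chart M E) (g : E -> R^o) : finite_frame E ->
  atlas c -> Cinf (chart_img c) g -> smooth_on (chart_dom c) (g \o chart_map c).
Proof.
move=> fE cA Cg; have [cdo cio cK cc ci] := atlas_chart _ cA.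
apply/smooth_onP; split=> [x cx|d dA k].
  apply: continuous_comp; first exact: cc.
  by apply: (Cg 0); exists x.
apply: (@Ck_comp _ _ _ _ _ _ (chart_img c) (chart_map c \o chart_inv d) g) => //.
- exact: finite_frame_line.
- by apply: open_chart_img => //; exact: atlas_chart.
- have [ddo dio dK dc di] := atlas_chart _ dA.
  by move=> _ [x [dx cx] <-] /=; rewrite dK //; exists x.
- exact: atlas_compat.
Qed.
End real_valued.
End smooth_maps.

(** * Tangent vectors *)

Section tangent_theory.
Context {R : realType} {E : normedModType R} {M : atlasType E} (p : M).
Implicit Types (v : tangent p) (f g : smooth_fun M).

Lemma tangent_linear v a f g : v (a *: f + g) = a * v f + v g.
Proof. by have /asboolP[+ _] := valP v; exact. Qed.

Lemma tangentM v f g : v (f * g) = f p * v g + g p * v f.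
Proof. by have /asboolP[_] := valP v; exact. Qed.

Lemma tangent0 v : v 0 = 0.
Proof.
have := tangent_linear v 1 0 0; rewrite scaler0 add0r mul1r => /eqP.
by rewrite -subr_eq subrr eq_sym => /eqP.
Qed.

Lemma tangentD v f g : v (f + g) = v f + v g.
Proof. by rewrite -[f]scale1r tangent_linear mul1r scale1r. Qed.

Lemma tangentZ v a f : v (a *: f) = a * v f.
Proof. by rewrite -[a *: f]addr0 tangent_linear tangent0 addr0. Qed.

Lemma tangentN v f : v (- f) = - v f.
Proof. by rewrite -scaleN1r tangentZ mulN1r. Qed.

Lemma tangent1 v : v 1 = 0.
Proof.
have := tangentM v 1 1; rewrite mulr1 [X in X * _](_ : _ = 1) // mul1r => /eqP.
by rewrite -subr_eq subrr eq_sym => /eqP.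
Qed.

Lemma tangent_sum v n (f : 'I_n -> smooth_fun M) :
  v (\sum_i f i) = \sum_i v (f i).
Proof.
elim/big_rec2: _ => [|i x y _ <-]; first exact: tangent0.
exact: tangentD.
Qed.

Lemma smooth_fun_sumE n (f : 'I_n -> smooth_fun M) x : (\sum_i f i) x = \sum_i f i x.
Proof. by elim/big_rec2: _ => // i y z _ <-. Qed.

Lemma tangent_val_sum n (v : 'I_n -> tangent p) f : (\sum_i v i) f = \sum_i v i f.
Proof. by elim/big_rec2: _ => // i y z _ <-. Qed.

Lemma eq_tangent (v w : tangent p) : (forall f, v f = w f) -> v = w.
Proof. by move=> vw; apply/val_inj/funext. Qed.
End tangent_theory.

(** * Extension of local functions and locality of tangent vectors *)

Section extension.
Context {R : realType} {n : nat} {M : manifoldType R n}.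
Implicit Types (p : M) (W : set M).

Lemma exists_smooth_fun (f : M -> R^o) : smooth f -> exists g : smooth_fun M, forall x, g x = f x.
Proof.
move=> sf; have fP : f \in smooth_pred by apply/asboolP.
by exists (SmoothFun fP).
Qed.

(** A bump in a chart, extended by zero. The vanishing set is given as an open [O] covering [M]
    together with [W]: the product of [chi] with a function smooth on an open [W] is smooth on [W]
    and zero on [O], hence globally smooth. [O] is open because the compact image of the support is
    closed in a Hausdorff space. *)
Lemma exists_bump p W : nbhs p W -> exists chi : smooth_fun M,
  (\forall x \near p, chi x = 1) /\
  exists O : set M, [/\ open O, forall x, W x \/ O x & forall x, O x -> chi x = 0].
Proof.
rewrite nbhsE => -[V [Vo Vp] VW].
have [c cA cp] := atlas_cover p; have cc := atlas_chart _ cA.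
have [cdo cio cK cm ci] := cc.
have Uo := open_chart_img cc Vo.
have Up : nbhs (chart_map c p) (chart_map c @` (chart_dom c `&` V)).
  by apply: open_nbhs_nbhs; split=> //; exists p.
have [b [K [Cb b1 Kc KU b0]]] := exists_rV_bump Up.
pose chi x : R^o := if `[< chart_dom c x >] then b (chart_map c x) else 0.
pose O : set M := ~` (chart_inv c @` K).
have Oo : open O.
  apply: closed_openC; apply: compact_closed; first exact: manifold_hausdorff.
  apply: continuous_compact => //.
  apply: continuous_in_subspaceT => u /set_mem /KU [x [cx _] <-].
  by apply: ci; exists x.
have chi0 x : O x -> chi x = 0.
  rewrite /chi; case: asboolP => // cx Ox; apply: b0 => Kx.
  by apply: Ox; exists (chart_map c x) => //; rewrite cK.
have sO : smooth_on O chi.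
  apply: (@eq_smooth_on R _ R^o M R^o _ (fun=> 0)) => //; first by move=> x /chi0.
  exact: smooth_on_cst.
have sc : smooth_on (chart_dom c) chi.
  apply: (@eq_smooth_on R _ R^o M R^o _ (b \o chart_map c)) => //.
    by move=> x cx; rewrite /chi asboolT.
  apply: smooth_on_chart => //; first exact: finite_frame_rV.
  by move=> k; apply: Ck_sub (Cb k).
have WO x : V x /\ chart_dom c x \/ O x.
  have [Ox|/contrapT[u /KU[y [cy Vy] <-] <-]] := pselect (O x); first by right.
  by left; rewrite cK.
have [|chi' chiE] := @exists_smooth_fun chi.
  apply: smooth_on_cover => x _; have [[_ cx]|Ox] := WO x.
    by exists (chart_dom c).
  by exists O.
exists chi'; split.
  have := cm _ cp; rewrite /continuous_at => /(_ _ b1); rewrite near_simpl => H.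
  near=> x; rewrite chiE /chi asboolT; last by near: x; exact: open_nbhs_nbhs.
  by near: x.
exists O; split=> // [x|x Ox]; last by rewrite chiE chi0.
by have [[/VW Wx _]|Ox] := WO x; [left|right].
Unshelve. all: by end_near. Qed.

Lemma extend_smooth p W (f : M -> R^o) : open W -> W p -> smooth_on W f ->
  exists g : smooth_fun M, \forall x \near p, g x = f x.
Proof.
move=> Wo Wp sf; have [chi [chi1 [Q [Oo WO chi0]]]] := exists_bump (open_nbhs_nbhs (conj Wo Wp)).
have schi : smooth (chi : M -> R^o) by exact: (asboolW (valP chi)).
have [|g gE] := @exists_smooth_fun ((chi : M -> R^o) * f).
  apply: smooth_on_cover => x _; have [Wx|Ox] := WO x.
    by exists W => //; apply: smooth_onM => //; exact: smooth_smooth_on.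
  exists Q => //; apply: (@eq_smooth_on R _ R^o M R^o _ (fun=> 0)) => //.
    by move=> y Oy; rewrite fctE chi0 // mul0r.
  exact: smooth_on_cst.
by exists g; apply: filterS chi1 => x x1; rewrite gE fctE x1 mul1r.
Qed.

(** For a bump [chi] vanishing away from the set where f = g, the product chi (f - g) is zero
    everywhere. As [chi] is 1 and f - g is 0 at [p], the Leibniz rule reduces its derivative to v f
    - v g. *)
Lemma tangent_local p (v : tangent p) (f g : smooth_fun M) :
  (\forall x \near p, f x = g x) -> v f = v g.
Proof.
move=> fg; have [chi [chi1 [Q [Oo WO chi0]]]] := exists_bump fg.
have fg0 : chi * (f - g) = 0.
  apply: smooth_funP => x; change (chi x * (f x - g x) = 0).
  by have [->|/chi0 ->] := WO x; rewrite (subrr, mul0r) ?mulr0.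
have := tangentM v chi (f - g); rewrite fg0 tangent0 (nbhs_singleton chi1).
rewrite [(f - g) p](_ : _ = f p - g p) // (nbhs_singleton fg) subrr mul0r addr0.
rewrite mul1r tangentD tangentN => /esym/eqP.
by rewrite subr_eq0 => /eqP.
Qed.
End extension.

Section coordinates.
Context {R : realType} {n : nat} {M : manifoldType R n}.
Context (p : M) (c : chart M 'rV[R]_n) (cA : atlas c) (cp : chart_dom c p).

Lemma smooth_fun_chart (f : smooth_fun M) : Cinf (chart_img c) (f \o chart_inv c).
Proof. by have /smooth_predP[_] := valP f; exact. Qed.

Let cimg : chart_img c (chart_map c p). Proof. by exists p. Qed.

Lemma exists_directional (a : 'rV[R]_n) : exists v : tangent p,
  forall f, v f = 'D_a (f \o chart_inv c) (chart_map c p).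
Proof.
have dF (f : smooth_fun M) : differentiable (f \o chart_inv c) (chart_map c p).
  exact: (smooth_fun_chart f 1).1.
have vP : (fun f : smooth_fun M => 'D_a (f \o chart_inv c) (chart_map c p) : R^o)
    \in derivation_at_pred p.
  have [_ _ cK _ _] := atlas_chart _ cA.
  apply/asboolP; split=> [b f g|f g].
    change ('D_a (b *: (f \o chart_inv c) + (g \o chart_inv c)) (chart_map c p) =
      b *: 'D_a (f \o chart_inv c) (chart_map c p) + 'D_a (g \o chart_inv c) (chart_map c p)).
    by rewrite deriveD ?deriveZ //; [exact/diff_derivable|apply: derivableZ|];
      exact: diff_derivable.
  change ('D_a ((f \o chart_inv c) * (g \o chart_inv c)) (chart_map c p) =
    f p * 'D_a (g \o chart_inv c) (chart_map c p) + g p * 'D_a (f \o chart_inv c) (chart_map c p)).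
  by rewrite deriveM; [rewrite /= cK|exact: diff_derivable..].
by exists (Tangent vP).
Qed.

(** The [y i] are global functions equal near [p] to the centred coordinates. Hadamard's lemma
    writes f near [p] as f(p) + sum of y_i h_i, with h_i(p) the i-th partial derivative. A
    derivation kills the constant, and since each y_i vanishes at [p] the Leibniz rule leaves the
    sum of v(y_i) h_i(p). *)
Lemma tangent_coordinates : exists y : 'I_n -> smooth_fun M,
  (\forall x \near p, forall i, y i x = (chart_map c x - chart_map c p) 0 i) /\
  forall (v : tangent p) f,
    v f = \sum_i v (y i) * 'D_(delta_mx 0 i) (f \o chart_inv c) (chart_map c p).
Proof.
have [cdo cio cK cm ci] := atlas_chart _ cA.
have fr := finite_frame_rV n (R := R).
have Ccoord i : Cinf setT (fun u : 'rV[R]_n => (u - chart_map c p) 0 i : R^o).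
  have lin_coord : linear (fun v : 'rV[R]_n => v 0 i : R^o).
    by move=> a u v; rewrite !mxE.
  pose l : {linear 'rV[R]_n -> R^o} := HB.pack (fun v : 'rV[R]_n => v 0 i : R^o)
    (GRing.isLinear.Build _ _ _ _ _ lin_coord).
  move=> k; have oT : open [set: 'rV[R]_n] by exact: openT.
  apply: (@Ck_lin_comp _ k _ _ _ setT l (idfun + cst (- chart_map c p))) => //.
    exact: coord_continuous.
  by apply: CkD => //; [exact: Ck_id|exact: Ck_cst].
have exy i : exists y : smooth_fun M, \forall x \near p, y x = (chart_map c x - chart_map c p) 0 i.
  apply: (extend_smooth cdo cp
    (f := (fun u : 'rV[R]_n => (u - chart_map c p) 0 i : R^o) \o chart_map c)).
  by apply: smooth_on_chart => // k; apply: Ck_sub (Ccoord i k).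
have [y Hy] := choice exy; exists y; split; first exact: (@filter_forall _ _ _ (nbhs p) _ Hy).
move=> v f; have [b [K [Cb b1 Kc KU b0]]] :=
  exists_rV_bump (open_nbhs_nbhs (conj cio cimg)).
(* [hadamard] asks for a function smooth on the whole space, so [f] read in the chart is cut off:
   the product is smooth on the chart image and zero on the complement of [K]. *)
pose F : 'rV[R]_n -> R^o := b * (f \o chart_inv c).
have CF : Cinf setT F.
  move=> k; apply: (@Ck_sub _ _ _ _ (chart_img c `|` ~` K)).
    by move=> u _; have [/KU|] := pselect (K u); [left|right].
  apply: Ck_setU.
    by apply: CkM => //; [apply: Ck_sub (Cb k)|exact: smooth_fun_chart].
  apply: (@eq_Ck _ _ _ _ _ (cst 0)); last exact: Ck_cst.
    by apply: closed_openC; apply: compact_closed => //; exact: norm_hausdorff.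
  by move=> u Ku; rewrite [RHS](_ : _ = b u * f (chart_inv c u)) // b0 // mul0r.
have [g [Cg gE FE]] := hadamard (chart_map c p) CF.
have exh i : exists h : smooth_fun M, \forall x \near p, h x = g i (chart_map c x).
  apply: (extend_smooth cdo cp (f := g i \o chart_map c)).
  by apply: smooth_on_chart => // k; apply: Ck_sub (Cg i k).
have [h Hh] := choice exh.
pose hf : smooth_fun M := f p *: (1 : smooth_fun M) + \sum_i y i * h i.
rewrite (@tangent_local _ _ _ _ v f hf).
  rewrite /hf tangent_linear tangent1 mulr0 add0r tangent_sum; apply: eq_bigr => i _.
  rewrite tangentM (nbhs_singleton (Hy i)) subrr mxE mul0r add0r mulrC.
  rewrite (nbhs_singleton (Hh i)) gE; congr (_ * _).
  by apply: near_eq_derive; apply: filterS b1 => u u1; rewrite /F fctE u1 mul1r.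
have near_c (P : set 'rV[R]_n) : (\forall u \near chart_map c p, P u) ->
  \forall x \near p, P (chart_map c x) by move=> HP; exact: (cm _ cp).
have Hy' := @filter_forall _ _ _ (nbhs p) _ Hy.
have Hh' := @filter_forall _ _ _ (nbhs p) _ Hh.
have b1' := near_c _ b1.
near=> x; have cx : chart_dom c x by near: x; exact: open_nbhs_nbhs.
have Hyx : forall i, y i x = (chart_map c x - chart_map c p) 0 i by near: x; exact: Hy'.
have Hhx : forall i, h i x = g i (chart_map c x) by near: x; exact: Hh'.
rewrite [hf x](_ : _ = f p * 1 + (\sum_i y i * h i) x) // smooth_fun_sumE mulr1.
have Fx : F (chart_map c x) = f x.
  have : b (chart_map c x) = 1 by near: x.
  by rewrite /F fctE => ->; rewrite mul1r /= cK.
rewrite -Fx FE; congr (_ + _).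
  by rewrite /F fctE (nbhs_singleton b1) mul1r /= cK.
apply: eq_bigr => i _; rewrite [RHS](_ : _ = y i x * h i x) //.
by rewrite Hyx Hhx !mxE.
Unshelve. all: by end_near. Qed.
End coordinates.

Lemma smooth_lineP {R : realType} (f : R^o -> R^o) : smooth f -> Cinf setT f.
Proof.
move=> /smooth_onP[_ /(_ line_chart erefl) Cf] k; have := Cf k.
by rewrite setIT image_id.
Qed.

Lemma near_chart_inv {R : realType} {E : normedModType R} {M : atlasType E}
    (c : chart M E) (p : M) (P : set M) : atlas c -> chart_dom c p ->
  (\forall x \near p, P x) ->
  \forall u \near chart_map c p, chart_img c u /\ P (chart_inv c u).
Proof.
move=> cA cp HP; have [cdo cio cK cm ci] := atlas_chart _ cA.
have cip : chart_img c (chart_map c p) by exists p.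
apply: filterI; first exact: (open_nbhs_nbhs (conj cio cip)).
by have := ci _ cip; rewrite /prop_for /continuous_at cK // => /(_ _ HP).
Qed.

Section frame.
Context {R : realType} {n : nat} {M : manifoldType R n}.
Implicit Types (p : M).

Lemma tangent_directional p (c : chart M 'rV[R]_n) (v : tangent p) :
  atlas c -> chart_dom c p -> exists a : 'rV[R]_n,
  forall f, v f = 'D_a (f \o chart_inv c) (chart_map c p).
Proof.
move=> cA cp; have [y [_ vE]] := tangent_coordinates cA cp.
exists (\row_i v (y i)) => f; rewrite vE derive_sum_partial.
  by apply: eq_bigr => i _; rewrite mxE.
by apply: (smooth_fun_chart cA f 1).1; exists p.
Qed.

Lemma exists_tangent_frame p :
  exists (d : 'I_n -> tangent p) (y : 'I_n -> smooth_fun M),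
    (forall i j, d i (y j) = (i == j)%:R) /\
    forall v : tangent p, v = \sum_i v (y i) *: d i.
Proof.
have [c cA cp] := atlas_cover p; have [cdo cio cK cm ci] := atlas_chart _ cA.
have [d dE] := choice (fun i => exists_directional cA cp (delta_mx 0 i)).
have [y [yE vE]] := tangent_coordinates cA cp.
exists d, y; split=> [i j|v]; last first.
  apply: eq_tangent => f; rewrite tangent_val_sum vE; apply: eq_bigr => i _.
  by rewrite -dE.
rewrite dE.
have lin_coord : linear (fun u : 'rV[R]_n => u 0 j : R^o).
  by move=> a u w; rewrite !mxE.
pose l : {linear 'rV[R]_n -> R^o} := HB.pack (fun v : 'rV[R]_n => v 0 j : R^o)
  (GRing.isLinear.Build _ _ _ _ _ lin_coord).
have cl : continuous l by exact: coord_continuous.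
have dl u : differentiable l u by exact: linear_differentiable.
transitivity ('D_(delta_mx 0 i)
  ((l : 'rV[R]_n -> R^o) + cst (- chart_map c p 0 j : R^o)) (chart_map c p)).
  apply: near_eq_derive.
  apply: filterS (near_chart_inv cA cp yE) => u [[x cx <-] yu].
  by rewrite /= yu cK // !mxE.
rewrite deriveD; [|exact: diff_derivable|exact: derivable_cst].
by rewrite derive_cst addr0 deriveE // diff_lin // /l /= mxE eqxx eq_sym.
Qed.

Lemma exists_velocity p (g : R^o -> M) : smooth g -> g 0 = p ->
  exists v : tangent p, forall f : smooth_fun M, v f = 'D_1 (f \o g : R^o -> R^o) 0.
Proof.
move=> sg <-; have dfg (f : smooth_fun M) : derivable (f \o g : R^o -> R^o) 0 1.
  have sf : smooth (f : M -> R^o) by exact: (asboolW (valP f)).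
  have sfg := smooth_comp (finite_frame_rV _) (finite_frame_line (R := R)) sg sf.
  by apply: diff_derivable; exact: (smooth_lineP sfg 1).1.
have vP : (fun f : smooth_fun M => 'D_1 (f \o g : R^o -> R^o) 0 : R^o)
    \in derivation_at_pred (g 0).
  apply/asboolP; split=> [b f h|f h].
    change ('D_1 (b *: (f \o g : R^o -> R^o) + (h \o g)) 0 =
      b *: 'D_1 (f \o g : R^o -> R^o) 0 + 'D_1 (h \o g : R^o -> R^o) 0).
    by rewrite deriveD ?deriveZ //; apply: derivableZ.
  change ('D_1 ((f \o g : R^o -> R^o) * (h \o g)) 0 =
    f (g 0) * 'D_1 (h \o g : R^o -> R^o) 0 + h (g 0) * 'D_1 (f \o g : R^o -> R^o) 0).
  by rewrite deriveM.
by exists (Tangent vP).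
Qed.

(** The curve is a straight line of a chart, slowed down by [phi] so as to stay in [W] for all
    times; [phi t = t] near 0 preserves the velocity. *)
Lemma tangent_velocity p (v : tangent p) (W : set M) : nbhs p W ->
  exists g : R^o -> M, [/\ smooth g, g 0 = p, forall t, W (g t) &
    forall f : smooth_fun M, v f = 'D_1 (f \o g : R^o -> R^o) 0].
Proof.
move=> Wp; have [c cA cp] := atlas_cover p.
have [cdo cio cK cm ci] := atlas_chart _ cA.
have [a aE] := tangent_directional v cA cp.
have /nbhs_ballP[e /= e0 eW] := near_chart_inv cA cp Wp.
(* With phi bounded by half of this number, [phi t *: a] has norm below [e], also when [a] is 0. *)
have d0 : 0 < e / (`|a| + 1) by rewrite divr_gt0 // ltr_wpDl.
have d2 : 0 < e / (`|a| + 1) / 2 by rewrite divr_gt0.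
have [phi [Cphi phi1 phie]] := exists_small_reparametrization d2.
pose h (t : R^o) : 'rV[R]_n := chart_map c p + phi t *: a.
have he t : ball (chart_map c p) e (h t).
  rewrite -ball_normE /= /h opprD addrA subrr sub0r normrN normrZ.
  apply: (@le_lt_trans _ _ (e / (`|a| + 1) / 2 * `|a|)); first by rewrite ler_wpM2r.
  have -> : e / (`|a| + 1) / 2 * `|a| = e * (`|a| / (`|a| + 1) / 2) by ring.
  have a0 := normr_ge0 a; have a1 : 0 < `|a| + 1 by lra.
  by rewrite gtr_pMr // !ltr_pdivrMr //; lra.
have Ch : Cinf setT h.
  move=> k; apply: CkD; [exact: openT|exact: Ck_cst|].
  by apply: CkZl; [exact: openT|exact: Cphi].
have phi0 : phi 0 = 0 by exact: (nbhs_singleton phi1).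
exists (chart_inv c \o h); split=> [||t|f].
- apply: (@smooth_into_chart _ _ _ R^o M setT line_chart c h) => //.
  + exact: finite_frame_line.
  + exact: finite_frame_rV.
  + exact: openT.
  + by move=> t _; case: (eW _ (he t)).
  + by rewrite image_id.
- by rewrite /= /h phi0 scale0r addr0 cK.
- by case: (eW _ (he t)).
- have df : differentiable (f \o chart_inv c) (chart_map c p + (0 : R) *: a).
    by rewrite scale0r addr0; apply: (smooth_fun_chart cA f 1).1; exists p.
  have [_ lineE] := is_derive_line df.
  rewrite aE; rewrite scale0r addr0 in lineE; rewrite -lineE.
  by apply: near_eq_derive; apply: filterS phi1 => t tE; rewrite /= /h tE.
Qed.
End frame.

(** The continuity demanded by [smooth_predP] already follows from C^0 in the charts. *)
Lemma smooth_from_charts {R : realType} {E : normedModType R} {P : atlasType E} (h : P -> R^o) :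
  (forall d : chart P E, atlas d -> Cinf (chart_img d) (h \o chart_inv d)) ->
  h \in smooth_pred.
Proof.
move=> Ch; apply/smooth_predP; split=> // y.
have [d dA dy] := atlas_cover y; have [ddo dio dK dc di] := atlas_chart _ dA.
have iy : chart_img d (chart_map d y) by exists y.
have cont : {for y, continuous ((h \o chart_inv d) \o chart_map d)}.
  by apply: continuous_comp; [exact: dc|exact: (Ch d dA 0)].
move: cont; rewrite /prop_for /continuous_at /= dK //; apply: cvg_trans.
apply: near_eq_cvg; near=> z; rewrite /= dK //; near: z; exact: open_nbhs_nbhs.
Unshelve. all: by end_near. Qed.

Section partial.
Context {R : realType} {n n' : nat} {M : manifoldType R n} {N : manifoldType R n'}.

(** In a product chart [v] is the directional derivative along some [a], so the function is a slice
    of the derivative of [F] along (a, 0). This and its mirror image give smoothness of the action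
    fields and of the left-invariant fields. *)
Lemma smooth_partiall (F : smooth_fun (M * N)%type) (p : M) (v : tangent p) :
  (fun y : N => v (slicel F y) : R^o) \in smooth_pred.
Proof.
apply: smooth_from_charts => d dA k.
have [c cA cp] := atlas_cover p; have [a vE] := tangent_directional v cA cp.
have [_ _ dK _ _] := atlas_chart _ dA.
have cdA : atlas (prod_chart c d) by exists (c, d).
have /smooth_predP[_ /(_ _ cdA k.+1)[_ /(_ (a, 0))]] := valP F.
move=> /(Ck_slicer (chart_map c p)).
have -> : [set w | chart_img (prod_chart c d) (chart_map c p, w)] = chart_img d.
  apply/seteqP; split=> [w [[x y] [_ /= dy] [_ <-]]|_ [y dy <-]]; first by exists y.
  by exists (p, y).
congr Ck; apply/funext => w; rewrite [RHS]vE /derive.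
set f1 := fun h : R => _; set f2 := fun h : R => _.
suff -> : f1 = f2 by [].
apply/funext => h; rewrite /f1 /f2 /=; congr (_ *: (F (_, chart_inv d _) - _)).
by rewrite scaler0 add0r.
Qed.

Lemma smooth_partialr (F : smooth_fun (M * N)%type) (q : N) (v : tangent q) :
  (fun x : M => v (slicer F x) : R^o) \in smooth_pred.
Proof.
apply: smooth_from_charts => c cA k.
have [d dA dq] := atlas_cover q; have [a vE] := tangent_directional v dA dq.
have [_ _ cK _ _] := atlas_chart _ cA.
have cdA : atlas (prod_chart c d) by exists (c, d).
have /smooth_predP[_ /(_ _ cdA k.+1)[_ /(_ (0, a))]] := valP F.
move=> /(Ck_slicel (chart_map d q)).
have -> : [set w | chart_img (prod_chart c d) (w, chart_map d q)] = chart_img c.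
  apply/seteqP; split=> [w [[x y] [/= cx _] [<- _]]|_ [x cx <-]]; first by exists x.
  by exists (x, q).
congr Ck; apply/funext => w; rewrite [RHS]vE /derive.
set f1 := fun h : R => _; set f2 := fun h : R => _.
suff -> : f1 = f2 by [].
apply/funext => h; rewrite /f1 /f2 /=; congr (_ *: (F (chart_inv c _, _) - _)).
by rewrite scaler0 add0r.
Qed.
End partial.

Section two_variables.
Context {R : realType} {n n' : nat} {M : manifoldType R n} {N : manifoldType R n'}.

(** The chain rule on the plane together with (1, 1) = (1, 0) + (0, 1). It computes the velocity of
    a product of two curves in a group. *)
Lemma derive_two_variables (F : smooth_fun (M * N)%type) (a : R^o -> M)
    (b : R^o -> N) : smooth a -> smooth b ->
  'D_1 (fun t : R^o => F (a t, b t) : R^o) 0 =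
  'D_1 (slicel F (b 0) \o a : R^o -> R^o) 0 + 'D_1 (slicer F (a 0) \o b : R^o -> R^o) 0.
Proof.
move=> sa sb; pose G (z : R^o * R^o) : R^o := F (a z.1, b z.2).
have sG : smooth (G : (R^o * R^o)%type -> R^o).
  apply: (smooth_comp _ (finite_frame_line (R := R)) (smooth_prod_map sa sb)).
    by apply: finite_frame_prod; exact: finite_frame_rV.
  exact: (asboolW (valP F)).
have dG : differentiable G (0, 0).
  have /smooth_onP[_ CG] := sG.
  have lA : atlas (prod_chart line_chart line_chart : chart (R^o * R^o)%type (R^o * R^o)%type).
    by exists (line_chart, line_chart).
  by apply: (CG _ lA 1).1; exists (0, 0).
have dGi (i : R^o -> R^o * R^o) : is_diff (0 : R^o) i i -> i 0 = (0, 0) ->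
    'D_1 (G \o i) 0 = 'd G (0, 0) (i 1).
  move=> di i0; have dGi0 : differentiable G (i 0) by rewrite i0.
  have di0 : differentiable i 0 by exact: ex_diff.
  rewrite deriveE; last exact: differentiable_comp.
  by rewrite diff_comp //= diff_val i0.
have i1 : is_diff (0 : R^o) (fun t : R^o => (t, t)) (fun t => (t, t)) by exact: is_diff_pair.
have i2 : is_diff (0 : R^o) (fun t : R^o => (t, 0 : R^o)) (fun t => (t, 0)).
  exact: is_diff_pair.
have i3 : is_diff (0 : R^o) (fun t : R^o => (0 : R^o, t)) (fun t => (0, t)).
  exact: is_diff_pair.
transitivity ('d G (0, 0) (1, 1)); first exact: (dGi _ i1).
have -> : (1, 1) = (1, 0) + (0, 1) :> R^o * R^o by congr pair; rewrite /= (addr0, add0r).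
rewrite linearD; congr (_ + _); symmetry; [exact: (dGi _ i2)|exact: (dGi _ i3)].
Qed.
End two_variables.

(** * Lie groups and homogeneous spaces *)

Section pullback.
Context {R : realType} {E : normedModType R} {n : nat}.
Context {M : atlasType E} {N : manifoldType R n} (phi : M -> N) (sphi : smooth phi).

Let pullback_subproof (f : smooth_fun N) : (f \o phi : M -> R^o) \in smooth_pred.
Proof.
apply/asboolP; apply: (smooth_comp (finite_frame_rV _) (finite_frame_line (R := R)) sphi).
exact: (asboolW (valP f)).
Qed.

Definition pullback (f : smooth_fun N) : smooth_fun M := SmoothFun (pullback_subproof f).

End pullback.

Section group_fields.
Context {R : realType} {n : nat} (G : lieGroupType R n).
Local Notation e := (1%g : G).

Let mul (z : (G * G)%type) : G := (z.1 * z.2)%g.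
Let smul : smooth mul. Proof. exact: mulg_smooth. Qed.

Section left_field.
Context (X : tangent e).

Let left_val (f : smooth_fun G) : smooth_fun G :=
  SmoothFun (smooth_partialr (pullback smul f) X).

Let left_linear a f g : left_val (a *: f + g) = a *: left_val f + left_val g.
Proof.
apply: smooth_funP => x.
change (X (slicer (pullback smul (a *: f + g)) x) =
  a * X (slicer (pullback smul f) x) + X (slicer (pullback smul g) x)).
by rewrite -tangent_linear; congr (X _); apply: smooth_funP.
Qed.

Let left_leibniz f g : left_val (f * g) = f * left_val g + g * left_val f.
Proof.
apply: smooth_funP => x.
change (X (slicer (pullback smul (f * g)) x) =
  f x * X (slicer (pullback smul g) x) + g x * X (slicer (pullback smul f) x)).
have -> : slicer (pullback smul (f * g)) x =
    slicer (pullback smul f) x * slicer (pullback smul g) x.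
  exact: smooth_funP.
by rewrite tangentM /= /mul /= mulg1.
Qed.

Definition left_field : vfield G := VField left_linear left_leibniz.

Lemma left_field_invariant : left_invariant left_field.
Proof.
move=> g f f' ff' x; rewrite /= /left_val /=; congr (X _).
by apply: smooth_funP => y; rewrite /= /mul /= ff' mulgA.
Qed.

Lemma left_field_at : vfield_at left_field e = X.
Proof.
apply: eq_tangent => f; rewrite /= /left_val /=; congr (X _).
by apply: smooth_funP => y; rewrite /= /mul /= mul1g.
Qed.
End left_field.

(** Both slices through the unit of (x, y) -> f(xy) are f, so multiplicativity at (e, e) says that
    w(e) + w(e) = w(e). *)
Lemma poisson_lie_at_unit (w : bivector G) f g : is_poisson_lie w -> w f g e = 0.
Proof.
move=> [_ [_ /(_ f g (pullback smul f) (pullback smul g))]] => H.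
have := H (fun=> erefl) (fun=> erefl) (e, e); rewrite /prod_bracket /bracket /=.
have slE h : slicel (pullback smul h) e = h.
  by apply: smooth_funP => x; rewrite /= /mul /= mulg1.
have srE h : slicer (pullback smul h) e = h.
  by apply: smooth_funP => x; rewrite /= /mul /= mul1g.
rewrite !slE !srE mulg1 => wE.
by apply: (@addrI _ (w f g e : R)); rewrite addr0.
Qed.

(** For every field [X], the terms w (X f) g and w f (X g) of the Schouten bracket vanish at [e],
    which leaves X (w f g). *)
Lemma dual_bracket_differential (w : bivector G) f g : is_poisson_lie w ->
  dual_bracket w (differential e f) (differential e g) = differential e (w f g).
Proof.
move=> wG; have wE X : vfield_at X e (w f g) =
    bivector_at (schouten X w) (differential e f) (differential e g).
  rewrite bivector_at_differential.
  change (X (w f g) e = X (w f g) e - w (X f) g e - w f (X g) e).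
  by rewrite !(poisson_lie_at_unit _ _ wG) !subr0.
apply: xget_unique => [X _|zeta Hz]; first exact: wE.
(* Uniqueness: every tangent vector at [e] is the value of a left-invariant field, so the defining
   condition fixes [zeta]. *)
apply/val_inj/funext => X; rewrite -(left_field_at X).
exact: etrans (Hz _ (@left_field_invariant X)) (esym (wE (left_field X))).
Qed.
End group_fields.

(** * Tangent vectors of the coset space *)

Section coset.
Context {R : realType} {n m : nat} (G : lieGroupType R n) (H : set G).
Context (M : manifoldType R m) (q : G -> M).
Hypotheses (subH : is_subgroup H) (cosetq : is_coset_projection H q).
Hypothesis sact : smooth (coset_action q).
Local Notation e := (1%g : G).

Local Notation sq := (coset_smooth cosetq).
Let smul : smooth (fun z : (G * G)%type => (z.1 * z.2)%g). Proof. exact: mulg_smooth. Qed.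

Lemma coset_projection_mulr g h : H h -> q (g * h)%g = q g.
Proof.
by move=> Hh; symmetry; apply/(coset_fiber cosetq); rewrite mulKg.
Qed.

Lemma coset_unitP g : q g = q e -> H g^-1%g.
Proof. by move=> /(coset_fiber cosetq); rewrite mulg1. Qed.

Let coset_repr x : q (xget e [set g | q g = x]) = x.
Proof. exact: (xgetPex e (coset_surj cosetq x)). Qed.

(** The representative of [q e] chosen in [coset_action] need not be [e], but it lies in [H] and is
    absorbed by [q]. *)
Lemma coset_action_base g : coset_action q (g, q e) = q g.
Proof.
rewrite /coset_action /=; apply: coset_projection_mulr.
have [H1 Hdiv] := subH; rewrite -[X in H X]invgK -[X in H X]mulg1.
by apply: Hdiv => //; apply: coset_unitP; exact: coset_repr.
Qed.

Lemma coset_action_unit x : coset_action q (e, x) = x.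
Proof. by rewrite /coset_action /= mul1g. Qed.

Section action_field.
Context (X : tangent e).

Let act_val (f : smooth_fun M) : smooth_fun M :=
  SmoothFun (smooth_partiall (pullback sact f) X).

Let act_linear a f g : act_val (a *: f + g) = a *: act_val f + act_val g.
Proof.
apply: smooth_funP => x.
change (X (slicel (pullback sact (a *: f + g)) x) =
  a * X (slicel (pullback sact f) x) + X (slicel (pullback sact g) x)).
by rewrite -tangent_linear; congr (X _); apply: smooth_funP.
Qed.

Let act_leibniz f g : act_val (f * g) = f * act_val g + g * act_val f.
Proof.
apply: smooth_funP => x.
change (X (slicel (pullback sact (f * g)) x) =
  f x * X (slicel (pullback sact g) x) + g x * X (slicel (pullback sact f) x)).
have -> : slicel (pullback sact (f * g)) x =
    slicel (pullback sact f) x * slicel (pullback sact g) x.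
  exact: smooth_funP.
by rewrite tangentM /= coset_action_unit.
Qed.

(** The infinitesimal action of [X]: at [x] it differentiates f(gx) in g at the unit. Its value at
    [q e] is the image of [X] under the differential of [q], so these fields extend tangent vectors
    at [q e]. *)
Definition action_field : vfield M := VField act_linear act_leibniz.

Lemma action_field_base f : vfield_at action_field (q e) f = X (pullback sq f).
Proof.
rewrite /= /act_val /=; congr (X _).
by apply: smooth_funP => g; rewrite /= coset_action_base.
Qed.
End action_field.

(* A local section through a point of the fibre over [q e], translated on the *)
(* right so as to send [q e] to [e].                                          *)
Lemma exists_based_section : exists (W : set M) (s : M -> G),
  [/\ open W, W (q e), smooth_on W s, s (q e) = e & forall y, W y -> q (s y) = y].
Proof.
have [W [s [Wo We ss qs]]] := coset_section cosetq (q e).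
exists W, (fun y => (s y * (s (q e))^-1)%g); split=> //.
- have sp := smooth_on_pair Wo ss (smooth_on_cst (s (q e))^-1%g Wo).
  have fr := finite_frame_rV n (R := R).
  exact: (smooth_on_comp (finite_frame_prod fr fr) fr Wo openT (fun _ _ => Logic.I) sp
    (smooth_smooth_on _ smul)).
- by rewrite mulgV.
- move=> y Wy; rewrite coset_projection_mulr ?qs //.
  by apply: coset_unitP; exact: qs.
Qed.

(** A curve with velocity [v] inside the domain of a local section [s] is lifted by [s]; the lift
    starts at [e] because s(q e) = e. *)
Lemma tangent_coset_surjective (v : tangent (q e)) :
  exists X : tangent e, forall f, X (pullback sq f) = v f.
Proof.
have [W [s [Wo We ss se qs]]] := exists_based_section.
have [c [sc c0 Wc vE]] := tangent_velocity v (open_nbhs_nbhs (conj Wo We)).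
have ssc : smooth (s \o c : R^o -> G).
  exact: (smooth_on_comp (finite_frame_rV _) (finite_frame_rV _) openT Wo (fun t _ => Wc t) sc ss).
have [|X XE] := exists_velocity ssc (p := e); first by rewrite /= c0.
exists X => f; rewrite XE vE.
have -> // : pullback sq f \o (s \o c) = f \o c :> (R^o -> R^o).
by apply/funext => t; rewrite /= qs.
Qed.

(** The Lie algebra of [H] is the kernel of the differential of [q]. For the converse, take a curve
    [c] with velocity [X] and replace it by s(q c)^(-1) c, which lies in [H]. The correcting factor
    depends on [c] only through q c, whose velocity is zero, so the velocity remains [X]. *)
Lemma lie_algebra_ofP (X : tangent e) :
  lie_algebra_of H X <-> forall f, X (pullback sq f) = 0.
Proof.
have [H1 Hdiv] := subH; split=> [[g [sg g0 Hg XE]] f|X0].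
  rewrite XE (_ : _ \o _ = cst (f (q e))) ?derive_cst //.
  apply/funext => t; rewrite /=; congr (f _); symmetry.
  by apply/(coset_fiber cosetq); rewrite invg1 mul1g.
have [W [s [Wo We ss se qs]]] := exists_based_section.
have cq : continuous q by move=> x; have [+ _] := sq; exact.
have Wq : nbhs e (q @^-1` W) by apply: cq; exact: open_nbhs_nbhs.
have [c [sc c0 Wc XE]] := tangent_velocity X Wq.
have fr k := finite_frame_rV k (R := R).
have sqc : smooth (q \o c : R^o -> M) by exact: (smooth_comp (fr _) (fr _) sc sq).
have sinv : smooth_on W (fun y => (s y)^-1%g).
  exact: (smooth_on_comp (fr _) (fr _) Wo openT (fun _ _ => Logic.I) ss
    (smooth_smooth_on _ invg_smooth)).
pose r t := (s (q (c t)))^-1%g.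
have sr : smooth (r : R^o -> G).
  exact: (smooth_on_comp (fr _) (fr _) openT Wo (fun t _ => Wc t) sqc sinv).
have r0 : r 0 = e by rewrite /r c0 se invg1.
exists (fun t => (r t * c t)%g); split.
- have srp := smooth_on_pair openT sr sc.
  apply: (smooth_comp _ (fr _) srp smul).
  exact: (finite_frame_prod (fr _) (fr _)).
- by rewrite r0 c0 mulg1.
- by move=> t; rewrite /r; apply/(coset_fiber cosetq); rewrite qs //; exact: Wc.
- move=> f; have := derive_two_variables (pullback smul f) sr sc.
  rewrite c0 r0.
  have -> : slicel (pullback smul f) e = f.
    by apply: smooth_funP => x; rewrite /= mulg1.
  have -> : slicer (pullback smul f) e = f.
    by apply: smooth_funP => x; rewrite /= mul1g.
  rewrite -XE /= => ->.
  have sf : smooth_on W ((f : G -> R^o) \o (fun y => (s y)^-1%g)).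
    apply: (smooth_on_comp (fr _) (finite_frame_line (R := R)) Wo openT (fun _ _ => Logic.I) sinv).
    exact: (asboolW (valP f)).
  have [g gE] := extend_smooth Wo We sf.
  (* Near 0 the function f o r equals g o q o c, where [g] extends y -> f(s(y)^(-1)); its derivative
     is thus [X] on a pullback, which is 0. *)
  have fr0 : 'D_1 (f \o r : R^o -> R^o) 0 = X (pullback sq g).
    rewrite XE; symmetry.
    apply: (@near_eq_derive R R^o R^o (pullback sq g \o c) (f \o r)).
    have cqc : continuous (q \o c) by move=> t; have [+ _] := sqc; exact.
    by have := cqc 0; rewrite /continuous_at /= c0 => /(_ _ gE).
  by rewrite [X in X + _](etrans fr0 (X0 g)) add0r.
Qed.
End coset.

(** * Unimodularity *)

Lemma lie_sumr (R : realType) (V : lmodType R) (K : set V) (br : V -> V -> V)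
    (u : V) n (c : 'I_n -> R) (v : 'I_n -> V) : is_lie_algebra K br ->
  K u -> (forall i, K (v i)) -> br u (\sum_i c i *: v i) = \sum_i c i *: br u (v i).
Proof.
move=> lie Ku Kv; have [K0 Klin] := lie_subspace lie.
have br0 : br u 0 = 0.
  have := lie_linearr lie 1 K0 K0 Ku; rewrite scaler0 addr0 scale1r => E.
  by apply: (@addrI _ (br u 0)); rewrite addr0.
(* Linearity of [br] holds only on [K], so membership of the partial sums is carried through the
   induction. *)
suff [] : K (\sum_i c i *: v i) /\ br u (\sum_i c i *: v i) = \sum_i c i *: br u (v i) by [].
elim/big_rec2: _ => // i x z _ [Kz zE]; split; first exact: Klin.
by rewrite (lie_linearr lie) // zE.
Qed.

Section trace.
Context {R : realType} {V : lmodType R} (K : set V).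

Let coordinates_unique n (b : 'I_n -> V) (A B : 'I_n -> R) : is_basis K b ->
  K (\sum_i A i *: b i) -> \sum_i A i *: b i = \sum_i B i *: b i -> forall i, A i = B i.
Proof.
move=> [_ Hb] KA AB i; have [c [_ cU]] := Hb _ KA.
have := cU (\row_i A i); have := cU (\row_i B i).
have -> : \sum_i (\row_i B i) 0 i *: b i = \sum_i A i *: b i.
  by rewrite AB; apply: eq_bigr => j _; rewrite mxE.
have -> : \sum_i (\row_i A i) 0 i *: b i = \sum_i A i *: b i.
  by apply: eq_bigr => j _; rewrite mxE.
move=> /(_ erefl) -> /(_ erefl) /rowP/(_ i).
by rewrite !mxE.
Qed.

Let change_of_basis n n' (b : 'I_n -> V) (b' : 'I_n' -> V) :
  is_basis K b -> is_basis K b' ->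
  exists P : 'M[R]_(n, n'), forall j, b' j = \sum_i P i j *: b i.
Proof.
move=> [_ Hb] [Kb' _]; have [P HP] := choice (fun j => Hb _ (Kb' j)).
exists (\matrix_(i, j) P j 0 i) => j; have [-> _] := HP j.
by apply: eq_bigr => i _; rewrite mxE.
Qed.

Let sum_mulmx n n' n'' (b : 'I_n -> V) (P : 'M[R]_(n, n')) (Q : 'M[R]_(n', n'')) j :
  \sum_i Q i j *: (\sum_k P k i *: b k) = \sum_k (P *m Q) k j *: b k.
Proof.
under eq_bigr do rewrite scaler_sumr; rewrite exchange_big; apply: eq_bigr => k _.
by rewrite mxE scaler_suml; apply: eq_bigr => i _; rewrite scalerA mulrC.
Qed.

Let change_of_basisK n n' (b : 'I_n -> V) (b' : 'I_n' -> V)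
    (P : 'M[R]_(n, n')) (Q : 'M[R]_(n', n)) : is_basis K b ->
  (forall j, b' j = \sum_i P i j *: b i) -> (forall j, b j = \sum_i Q i j *: b' i) ->
  P *m Q = 1%:M.
Proof.
move=> Hb HP HQ; apply/matrixP => k j.
have E : \sum_k (P *m Q) k j *: b k = \sum_k (1%:M : 'M[R]_n) k j *: b k.
  rewrite -sum_mulmx -(eq_bigr _ (fun i _ => congr1 _ (HP i))) -HQ (bigD1 j) //=.
  rewrite mxE eqxx scale1r big1 ?addr0 // => i ij.
  by rewrite mxE (negbTE ij) scale0r.
apply: (coordinates_unique (A := fun k => (P *m Q) k j) Hb _ E).
by rewrite -sum_mulmx -(eq_bigr _ (fun i _ => congr1 _ (HP i))) -HQ; exact: Hb.1.
Qed.

(** The basis selected by [trace_on] may a priori have another size, so the changes of basis [P] and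
    [Q] are rectangular. From PQ = 1, QP = 1 and A = P A' Q, cyclicity of the trace gives tr A = tr
    A'. *)
Lemma trace_on_eq (phi : V -> V) n (b : 'I_n -> V) (A : 'M[R]_n) :
  is_basis K b -> (forall j, K (phi (b j))) ->
  (forall n (c : 'I_n -> R) (v : 'I_n -> V), (forall i, K (v i)) ->
    phi (\sum_i c i *: v i) = \sum_i c i *: phi (v i)) ->
  (forall j, phi (b j) = \sum_i A i j *: b i) ->
  trace_on K phi = \tr A.
Proof.
move=> Hb Kphi linphi HA; apply: xget_unique; first by exists n, b, A; split.
move=> _ [n' [b' [A' [Hb' HA' ->]]]].
have [P HP] := change_of_basis Hb Hb'; have [Q HQ] := change_of_basis Hb' Hb.
have PQ := change_of_basisK Hb HP HQ; have QP := change_of_basisK Hb' HQ HP.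
suff AE : A = P *m A' *m Q by rewrite AE -mulmxA mxtrace_mulC -mulmxA QP mulmx1.
apply/matrixP => k j.
apply: (coordinates_unique (A := fun k => A k j) (B := fun k => (P *m A' *m Q) k j) Hb).
  by rewrite -HA.
rewrite -HA {1}HQ linphi; last by move=> i; exact: Hb'.1.
rewrite -sum_mulmx; apply: eq_bigr => i _; rewrite HA' -sum_mulmx.
by congr (_ *: _); apply: eq_bigr => l _; rewrite HP.
Qed.
End trace.

(** * Volume forms and the divergence at a zero of the Poisson structure *)

Section volume.
Context {R : realType} {m : nat} {M : manifoldType R m}.

(** Every term of the sum but the i-th repeats an argument and is killed by alternation. The lemma
    turns a sum of substitutions into a trace and also detects linear dependence. *)
Lemma form_slot (nu : Defs.form M m) (p : M) (v : 'I_m -> tangent p) (c : 'I_m -> R) i :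
  nu p [eta v with i |-> \sum_j c j *: v j] = c i * nu p v.
Proof.
pose F (x : tangent p) := nu p [eta v with i |-> x].
have FD a x y : F (a *: x + y) = a * F x + F y by exact: form_linear.
have F0 : F 0 = 0.
  have := FD 1 0 0; rewrite scaler0 addr0 mul1r => F00.
  by apply: (@addrI _ (F 0)); rewrite addr0.
have Fsum : F (\sum_j c j *: v j) = \sum_j c j * F (v j).
  by elim/big_rec2: _ => // j x y _ <-; exact: FD.
rewrite -/(F _) Fsum (bigD1 i) //= big1 ?addr0 => [|j ji].
  by congr (_ * nu p _); apply/funext => k /=; case: eqP => // ->.
rewrite [F _](@form_alternating _ _ _ _ nu p _ i j) ?mulr0 //; first by rewrite eq_sym.
by rewrite /= eqxx (negbTE ji).
Qed.

(* At a zero of [w] the hamiltonian vector field of [h] vanishes, so that its  *)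
(* divergence is the trace of its linearization; for the volume form with      *)
(* modular field [hamiltonian w F] it is also [w F h], which is zero there.    *)
Lemma unimodular_linearization_trace (w : bivector M) (p : M) (h : smooth_fun M)
    (d : 'I_m -> tangent p) (y : 'I_m -> smooth_fun M) :
  is_unimodular_poisson w -> (forall f g, w f g p = 0) ->
  (forall v : tangent p, v = \sum_i v (y i) *: d i) ->
  (forall v : tangent p, exists Y : vfield M, vfield_at Y p = v) ->
  \sum_i d i (w h (y i)) = 0.
Proof.
move=> [nu nu0 [F modF]] w0 dE ext; have [v nuv] := nu0 p.
have [Y YE] := choice (fun i => ext (v i)).
pose X := hamiltonian w h.
pose z i := vfield_at (lie_bracket X (Y i)) p.
(* The field [X] vanishes at [p], so only the half of the commutator that differentiates the
   coefficients of [X] survives. *)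
have zE i g : z i g = - v i (w h g).
  change (X (Y i g) p - Y i (X g) p = - v i (w h g)).
  by rewrite [X _ p]w0 sub0r -YE.
(* The modular identity at [p]: the derivative of the form along [X] and the right-hand side are
   values of [w] at [p], hence zero, and the sum over brackets remains. *)
have sum0 : \sum_i nu p [eta v with i |-> z i] = 0.
  have := congr1 (fun f : smooth_fun M => f p) (modF h Y).
  have nuE i : form_eval nu [eta Y with i |-> lie_bracket X (Y i)] p =
      nu p [eta v with i |-> z i].
    rewrite /form_eval /=; congr (nu p _); apply/funext => j /=.
    by case: eqP => // _; rewrite YE.
  move=> E; have {}E : X (form_eval nu Y) p
      - \sum_i form_eval nu [eta Y with i |-> lie_bracket X (Y i)] p =
      w F h p * form_eval nu Y p.
    by rewrite -smooth_fun_sumE; exact: E.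
  move: E; rewrite [X _ p]w0 w0 mul0r sub0r => /eqP; rewrite oppr_eq0 => /eqP E0.
  rewrite -[RHS]E0.
  by apply: eq_bigr => i _; rewrite nuE.
pose B : 'M[R]_m := \matrix_(i, k) v i (y k).
pose A : 'M[R]_m := \matrix_(j, k) d j (w h (y k)).
have vE i : v i = \sum_k B i k *: d k by rewrite {1}(dE (v i)); apply: eq_bigr => k _; rewrite mxE.
(* The vectors [v i] are independent: a relation with a nonzero coefficient u_i would give u_i nu(v)
   = 0 by [form_slot]. *)
have Bu : B \in unitmx.
  rewrite -row_free_unit -kermx_eq0; apply/negPn/negP => /rowV0Pn[u /sub_kermxP uB u0].
  have /rV0Pn[i ui] := u0.
  have := form_slot nu v (fun j => u 0 j) i.
  have -> : \sum_j u 0 j *: v j = \sum_j (0 : R) *: v j.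
    transitivity (\sum_k (u *m B) 0 k *: d k).
      under eq_bigr => j _ do rewrite vE scaler_sumr.
      rewrite exchange_big; apply: eq_bigr => k _; rewrite mxE scaler_suml.
      by apply: eq_bigr => j _; rewrite scalerA.
    by rewrite uB !big1 // => k _; rewrite ?mxE scale0r.
  rewrite form_slot mul0r => /esym/eqP; rewrite mulf_eq0.
  by rewrite (negbTE ui) (negbTE nuv).
(* The linearization written in the frame [v] instead of [d]; the form computes the trace of [C],
   and conjugation by [B] carries it to [A]. *)
pose C := B *m A *m invmx B.
have zC i : z i = \sum_j (- C i j) *: v j.
  transitivity (\sum_k (- (C *m B) i k) *: d k).
    rewrite /C mulmxKV //= {1}(dE (z i)); apply: eq_bigr => k _; rewrite zE vE.
    rewrite tangent_val_sum [(B *m A) i k]mxE; congr (- _ *: _).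
    by apply: eq_bigr => j _; rewrite [A j k]mxE.
  under [RHS]eq_bigr => j _ do rewrite vE scaler_sumr.
  rewrite [RHS]exchange_big; apply: eq_bigr => k _; rewrite mxE -sumrN scaler_suml.
  by apply: eq_bigr => j _; rewrite scalerA mulNr.
have trC : \tr C = 0.
  have : - \tr C * nu p v = 0.
    rewrite -[RHS]sum0 /mxtrace -sumrN mulr_suml; apply: eq_bigr => i _.
    by rewrite zC form_slot.
  by move=> /eqP; rewrite mulf_eq0 (negbTE nuv) orbF oppr_eq0 => /eqP.
transitivity (\tr A); first by apply: eq_bigr => i _; rewrite mxE.
by rewrite -trC /C mxtrace_mulC mulmxA mulVmx // mul1mx.
Qed.
End volume.

Section dual_theory.
Context {R : realType} {V : lmodType R}.
Implicit Types (xi eta : dual V) (u v : V).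

Lemma dual_linear xi a u v : xi (a *: u + v) = a * xi u + xi v.
Proof. by have /asboolP := valP xi; exact. Qed.

Lemma dual0 xi : xi 0 = 0.
Proof.
have := dual_linear xi 1 0 0; rewrite scaler0 addr0 mul1r => E.
by apply: (@addrI _ (xi 0 : R)); rewrite addr0.
Qed.

Lemma dual_sum xi n (a : 'I_n -> R) (u : 'I_n -> V) :
  xi (\sum_i a i *: u i) = \sum_i a i * xi (u i).
Proof. by elim/big_rec2: _ => [|i x y _ <-]; [exact: dual0|exact: dual_linear]. Qed.

Lemma eq_dual xi eta : (forall u, xi u = eta u) -> xi = eta.
Proof. by move=> E; apply/val_inj/funext. Qed.

Lemma dual_val_sum n (a : 'I_n -> R) (xi : 'I_n -> dual V) u :
  (\sum_i a i *: xi i) u = \sum_i a i * xi i u.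
Proof. by elim/big_rec2: _ => // i x y _ <-. Qed.

Lemma annihilator_subspace (U : set V) : is_subspace (annihilator U).
Proof.
split=> [u _|a xi eta Hxi Heta u Uu] //.
change (a * xi u + eta u = 0); by rewrite Hxi // Heta // mulr0 addr0.
Qed.
End dual_theory.

Lemma differential_linear {R : realType} {E : normedModType R} {M : atlasType E}
    (p : M) a (f g : smooth_fun M) :
  differential p (a *: f + g) = a *: differential p f + differential p g.
Proof. by apply: eq_dual => v; exact: tangent_linear. Qed.

(** * The annihilator as the cotangent space at the base point *)

Section coisotropic.
Context {R : realType} {n m : nat} (G : lieGroupType R n) (PiG : bivector G).
Context (H : set G) (M : manifoldType R m) (q : G -> M) (Pi : bivector M).
Hypotheses (subH : is_subgroup H) (cosetq : is_coset_projection H q).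
Hypotheses (poisG : is_poisson_lie PiG) (coisoq : is_coisotropic_quotient PiG q Pi).
Local Notation e := (1%g : G).
Local Notation h0 := (annihilator (lie_algebra_of H)).
Local Notation br := (dual_bracket PiG).

Local Notation sq := (coset_smooth cosetq).
Let sact : smooth (coset_action q). Proof. by case: coisoq => -[_ []]. Qed.
Local Notation pb := (pullback sq).
Local Notation dpb f := (differential e (pb f)).

Lemma coisotropic_pullback f g : PiG (pb f) (pb g) = pb (Pi f g).
Proof.
apply: smooth_funP => x; have [_ [_ Hq]] := coisoq.
exact: (Hq f g (pb f) (pb g) (fun=> erefl) (fun=> erefl) x).
Qed.

Lemma coisotropic_at_base f g : Pi f g (q e) = 0.
Proof.
rewrite -[RHS](poisson_lie_at_unit (pb f) (pb g) poisG).
by rewrite coisotropic_pullback.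
Qed.

Lemma bracket_pullback f g : br (dpb f) (dpb g) = dpb (Pi f g).
Proof. by rewrite dual_bracket_differential // coisotropic_pullback. Qed.

(** Let [X i] lift [d i]. Then dpb (y j) takes the value 1 at X j and 0 at the other X i, and the
    [X i] span the tangent space at [e] modulo the Lie algebra of [H]. A covector of the annihilator
    is therefore determined by its values on the [X i]. *)
Lemma exists_annihilator_basis :
  exists (d : 'I_m -> tangent (q e)) (y : 'I_m -> smooth_fun M),
    [/\ forall v : tangent (q e), v = \sum_i v (y i) *: d i,
        is_basis h0 (fun i => dpb (y i)),
        forall f, dpb f = \sum_i d i f *: dpb (y i)
      & forall xi, h0 xi <-> exists f, xi = dpb f].
Proof.
have [d [y [dy dE]]] := exists_tangent_frame (q e).
have [X XE] := choice (fun i => tangent_coset_surjective cosetq (d i)).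
have h0_dpb f : h0 (dpb f).
  by move=> u /(lie_algebra_ofP subH cosetq) /(_ f).
(* The vector [u] is pushed down to [q e] as the value of its action field and expanded there in the
   frame [d]. *)
have uE (u : tangent e) f : \sum_i u (pb (y i)) * d i f = u (pb f).
  pose v := vfield_at (action_field cosetq sact u) (q e).
  have vE g : v g = u (pb g) by exact: action_field_base.
  by rewrite -vE (dE v) tangent_val_sum; apply: eq_bigr => i _; rewrite -vE.
have expand f : dpb f = \sum_i d i f *: dpb (y i).
  apply: eq_dual => u; rewrite dual_val_sum -[LHS]/(u (pb f)) -uE.
  by apply: eq_bigr => i _; rewrite mulrC.
have h0P xi : h0 xi -> exists f, xi = dpb f.
  move=> Hxi; exists (\sum_i xi (X i) *: y i); apply: eq_dual => u.
  (* [w] and [u] agree on all pullbacks, so their difference lies in the Lie algebra of [H] and [xi]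
     does not distinguish them. *)
  pose w := \sum_i u (pb (y i)) *: X i.
  have wE f : w (pb f) = u (pb f).
    by rewrite /w tangent_val_sum -uE; apply: eq_bigr => i _; rewrite -XE.
  have : xi (- 1 *: w + u) = 0.
    apply: Hxi; apply/(lie_algebra_ofP subH cosetq) => f.
    change (-1 * w (pb f) + u (pb f) = 0).
    by rewrite wE mulN1r addNr.
  rewrite dual_linear mulN1r addrC => /eqP; rewrite subr_eq0 => /eqP ->.
  rewrite /w dual_sum; change (\sum_i u (pb (y i)) * xi (X i) = u (pb (\sum_i xi (X i) *: y i))).
  rewrite -uE.
  apply: eq_bigr => i _; congr (_ * _).
  rewrite tangent_sum (bigD1 i) //= big1 ?addr0 => [|j ji].
    by rewrite tangentZ dy eqxx mulr1.
  by rewrite tangentZ dy eq_sym (negbTE ji) mulr0.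
exists d, y; split=> //; last by move=> xi; split=> [/h0P|[f ->]].
split=> [i|xi /h0P[f ->]]; first exact: h0_dpb.
exists (\row_i d i f); split=> [|c].
  by rewrite expand; apply: eq_bigr => i _; rewrite mxE.
move=> E; apply/rowP => j; rewrite mxE.
have := congr1 (fun xi : dual _ => xi (X j)) E.
rewrite dual_val_sum => /=; rewrite XE => ->; rewrite (bigD1 j) //= big1 ?addr0.
  by rewrite XE dy eqxx mulr1.
by move=> i ij; rewrite XE dy eq_sym (negbTE ij) mulr0.
Qed.
(** Every covector of [h0] is some [dpb f], so the axioms reduce to linearity, skew-symmetry and the
    Jacobi identity of [PiG] on functions; closure holds because the bracket of two pullbacks is a
    pullback. *)
Lemma annihilator_lie_algebra : is_lie_algebra h0 br.
Proof.
have [d [y [_ basis _ h0P]]] := exists_annihilator_basis.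
have brE f g : br (differential e f) (differential e g) = differential e (PiG f g).
  exact: dual_bracket_differential.
have differential0 : differential e (0 : smooth_fun G) = 0.
  by apply: eq_dual => v; exact: tangent0.
have differentialD (f g : smooth_fun G) :
    differential e (f + g) = differential e f + differential e g.
  by rewrite -[f]scale1r differential_linear !scale1r.
split.
- exact: annihilator_subspace.
- by exists m, (fun i => dpb (y i)).
- move=> _ _ /h0P[f ->] /h0P[g ->]; rewrite bracket_pullback.
  by apply/h0P; exists (Pi f g).
- move=> a _ _ _ /h0P[f ->] /h0P[g ->] /h0P[k ->].
  by rewrite -differential_linear !brE bivector_linear differential_linear.
- move=> a _ _ _ /h0P[f ->] /h0P[g ->] /h0P[k ->].
  by rewrite -differential_linear !brE bivector_linearr differential_linear.
- move=> _ /h0P[f ->]; rewrite brE (_ : PiG _ _ = 0) //.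
  apply: smooth_funP => x.
  have E : PiG (pb f) (pb f) x = - PiG (pb f) (pb f) x :> R :=
    congr1 (fun g : smooth_fun G => g x) (bivector_skew PiG (pb f) (pb f)).
  change (PiG (pb f) (pb f) x = 0 :> R); lra.
- move=> _ _ _ /h0P[f ->] /h0P[g ->] /h0P[k ->].
  by rewrite !brE -!differentialD poisG.1.
Qed.
End coisotropic.

Theorem theorem4p3 (R : realType) (n m : nat)
    (G : lieGroupType R n) (PiG : bivector G) (H : set G)
    (M : manifoldType R m) (q : G -> M) (Pi : bivector M) :
  connected [set: G]%classic ->
  is_poisson_lie PiG ->
  is_subgroup H -> closed H -> connected H ->
  is_coset_projection H q ->
  is_coisotropic_quotient PiG q Pi ->
  is_unimodular_poisson Pi ->
  is_unimodular_lie_algebra (annihilator (lie_algebra_of H)) (dual_bracket PiG).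
Proof.
move=> _ poisG subH _ _ cosetq coisoq unim.
have lie := annihilator_lie_algebra subH cosetq poisG coisoq.
have [d [y [dE basis expand h0P]]] := exists_annihilator_basis subH cosetq coisoq.
split=> // _ /h0P[f ->]; rewrite /modular_character.
have sact : smooth (coset_action q) by case: coisoq => -[_ []].
set u := differential _ _; have h0u : annihilator (lie_algebra_of H) u by apply/h0P; exists f.
have brE g : dual_bracket PiG u (differential 1%g (pullback (coset_smooth cosetq) g)) =
    differential 1%g (pullback (coset_smooth cosetq) (Pi f g)).
  exact: bracket_pullback.
(* The j-th basis vector dpb (y j) goes to dpb (Pi f (y j)), and [expand] reads off its
   coordinates. *)
rewrite (trace_on_eq (A := \matrix_(i, j) d i (Pi f (y j))) basis).
- transitivity (\sum_i d i (Pi f (y i))); first by apply: eq_bigr => i _; rewrite mxE.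
  apply: (unimodular_linearization_trace f unim) dE _ => [g k|v].
    exact: (coisotropic_at_base cosetq poisG coisoq).
  have [X XE] := tangent_coset_surjective cosetq v.
  (* The global extension of [v]: lift it to [X] at the unit and take the infinitesimal action of
     [X]. *)
  exists (action_field cosetq sact X); apply: eq_tangent => g.
  by rewrite -XE; exact: action_field_base.
- by move=> j; apply: lie.(lie_closed) => //; exact: basis.1.
- by move=> k c v Kv; rewrite (lie_sumr c lie h0u Kv).
- move=> j; rewrite brE expand.
  by apply: eq_bigr => i _; rewrite mxE.
Qed.
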